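(* For a right-continuous function $f:\mathbb{R}_+^d\to\mathbb{R}$, the following statements are equivalent: (i) $f$ is measure-inducing. (ii) $F^f$ generates a signed measure $\nu$ on $\mathbb{R}_+^d$ by $\nu([0,x])=F^f(x)$ for all $x\in\mathbb{R}_+^d$. (iii) There exist grounded, right-continuous, and $\Delta$-monotone functions $g,h:\mathbb{R}_+^d\to\mathbb{R}$, at least one of which is bounded, such that $$g(0)=h(0)=0,$$ $$F^f(x)=g(x)-h(x)\quad\text{for all }x\in\mathbb{R}_+^d,$$ $$\mathrm{Var_{HK}}(F^f|_{[0,x]})=\mathrm{Var_{HK}}(g|_{[0,x]})+\mathrm{Var_{HK}}(h|_{[0,x]})<\infty\quad\text{for all }x\in\mathbb{R}_+^d,$$ $$\Delta_{x,y}[f]=\Delta_{x,y}[g]-\Delta_{x,y}[h]\quad\text{for all }x,y\in\mathbb{R}_+^d\text{ with }x\le y.$$ (iv) There exist right-continuous and $d$-increasing functions $g,h:\mathbb{R}_+^d\to\mathbb{R}$, at least one of which is bounded, such that $\Delta_{x,y}[f]=\Delta_{x,y}[g]-\Delta_{x,y}[h]$ for all $x,y\in\mathbb{R}_+^d$ with $x\le y$. Further, the functions $g$ and $h$ in (iii) are uniquely determined.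
   Context: $\mathbb{R}_+=[0,\infty)$, $d\in\mathbb{N}$. Right-continuous means right-continuous in each component. Inequalities and maxima of vectors are componentwise; $[x,y]=\prod_i[x_i,y_i]$. A signed measure is a countably additive set function on the Borel sets with value $0$ at $\emptyset$, attaining at most one of the values $\pm\infty$. Difference operators: $\Delta_\varepsilon^if(z)=f(z+\varepsilon e_i)-f(z)$; for $x\le y$, $\Delta_{x,y}[f]=\Delta^1_{y_1-x_1}\cdots\Delta^d_{y_d-x_d}f(x)$; $D_{x,y}[f]=\lim_{\delta_1\downarrow0}\lim_{\varepsilon_1\downarrow0}\cdots\lim_{\delta_d\downarrow0}\lim_{\varepsilon_d\downarrow0}\Delta_{0\vee(x-\delta),\,y+\varepsilon}[f]$, whenever this iterated limit exists and coincides for all permutations of the limits. $f:\mathbb{R}_+^d\to\mathbb{R}$ is measure-inducing if there is a signed measure $\nu$ on $\mathbb{R}_+^d$ with $\nu([x,y])=D_{x,y}[f]$ for all $x\le y$ in $\mathbb{R}_+^d$. Lower $I$-marginals: for $I\subseteq\{1,\ldots,d\}$, $f_I((x_i)_{i\in I})=\lim_{x_j\downarrow0,\,j\notin I}f(x_1,\ldots,x_d)$ (iterated limit, independent of the order); $f_\emptyset$ is a constant and $f_{\{1,\ldots,d\}}=f$. $F^f(x)=f(x)-\sum_{I\subsetneq\{1,\ldots,d\}}(-1)^{d-|I|-1}f_I((x_i)_{i\in I})$. Grounded: $\lim_{x_j\downarrow0}f(x)=0$ for all $j$ and all $x_i\in\mathbb{R}_+$, $i\ne j$. $f$ is $k$-increasing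 if for all $\{i_1,\ldots,i_k\}\subseteq\{1,\ldots,d\}$ (distinct indices), $\Delta^{i_1}_{\varepsilon_1}\cdots\Delta^{i_k}_{\varepsilon_k}f(x)\ge0$ for all $x$ and all $\varepsilon_1,\ldots,\varepsilon_k>0$ (such that all points lie in the domain). $f$ is $\Delta$-monotone if it is $k$-increasing for all $k\in\{1,\ldots,d\}$. Hardy-Krause variation (anchored at the lower corner) of $f$ on a compact cuboid $[a,b]$: $\mathrm{Var_{HK}}(f)=\sum_{\emptyset\ne I\subseteq\{1,\ldots,d\}}\sup_{\mathcal{P}^I}\sum_{[x,y]\in\mathcal{P}^I}|\Delta_{x,y}[f_I]|$, where the supremum is over all partitions $\mathcal{P}^I$ of $\prod_{i\in I}[a_i,b_i]$ into axis-parallel boxes formed as products of one-dimensional partitions of the $[a_i,b_i]$, and $f_I$ is the lower $I$-marginal on $[a,b]$ (limit $x_j\downarrow a_j$ for $j\notin I$). *)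

(* Defs.v *)
From HB Require Import structures.
From mathcomp Require Import all_boot all_order all_algebra.
From mathcomp Require Import all_classical all_reals all_analysis.

Set Implicit Arguments.
Unset Strict Implicit.
Unset Printing Implicit Defensive.

Import Order.TTheory GRing.Theory Num.Theory.
Import numFieldNormedType.Exports.

Local Open Scope classical_set_scope.
Local Open Scope ring_scope.

(* A function on R_+^d is represented by a function on 'rV[R]_d whose values
   are only ever used on [orthant]; equality of two such functions means
   equality on [orthant]. *)

Section Orthant.
Context {R : realType} {d : nat}.
Implicit Types (f g h : 'rV[R]_d -> R) (a b x y e : 'rV[R]_d).

Definition vle x y : Prop := forall i, x 0 i <= y 0 i.

Definition orthant : set 'rV[R]_d := [set x | vle 0 x].

Definition box x y : set 'rV[R]_d := [set z | vle x z /\ vle z y].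

Definition borel_orthant : set_system 'rV[R]_d :=
  <<s orthant, [set orthant `&` U | U in [set U | open U]] >>.

Definition set_coord x (i : 'I_d) (t : R) : 'rV[R]_d :=
  \row_j (if j == i then t else x 0 j).

Definition component_right_continuous f : Prop :=
  forall x i, orthant x -> f (set_coord x i t) @[t --> (x 0 i)^'+] --> f x.

Definition grounded f : Prop :=
  forall x i, orthant x -> f (set_coord x i t) @[t --> 0^'+] --> (0 : R).

Definition bounded_on_orthant f : Prop := [bounded f x | x in orthant].

Definition diff_op (i : 'I_d) (eps : R) f : 'rV[R]_d -> R :=
  fun z => f (z + eps *: delta_mx 0 i) - f z.

Definition iter_diff (s : seq 'I_d) e f : 'rV[R]_d -> R :=
  foldr (fun i g => diff_op i (e 0 i) g) f s.

(* For I a proper subset this is the difference operator of a function of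
   (x_i)_{i in I}, seen as a function on R^d that ignores the other
   coordinates. *)
Definition Delta_on (I : {set 'I_d}) x y f : R := iter_diff (enum I) (y - x) f x.

Definition Delta x y f : R := Delta_on [set: 'I_d]%SET x y f.

Definition k_increasing (k : nat) f : Prop :=
  forall (s : seq 'I_d) x e, uniq s -> size s = k ->
    orthant x -> (forall i, 0 < e 0 i) -> 0 <= iter_diff s e f x.

Definition Delta_monotone f : Prop :=
  forall k, (0 < k <= d)%N -> k_increasing k f.

End Orthant.

Section IteratedLimit.
Context {R : realType} {V : eqType}.

Definition assign (p : V -> R) (v : V) (t : R) : V -> R :=
  fun w => if w == v then t else p w.

(* [iter_lim c [:: v1; ...; vn] G p l] states that the iterated right limit
     lim_{v1 decreasing to c v1} ... lim_{vn decreasing to c vn} G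
   exists and equals l, the head of the list being the outermost limit and
   the variables outside the list keeping the values given by p.  Each inner
   limit only has to exist for values of the outer variables close enough to
   their limit point. *)
Fixpoint iter_lim (c : V -> R) (s : seq V) (G : (V -> R) -> R)
    (p : V -> R) (l : R) : Prop :=
  if s is v :: s' then
    exists phi : R -> R,
      (\forall t \near (c v)^'+, iter_lim c s' G (assign p v t) (phi t)) /\
      phi t @[t --> (c v)^'+] --> l
  else G p = l.

End IteratedLimit.

Section SignedMeasure.
Context {R : realType} {T : Type}.

(* The library's charges are finite, so they do not cover signed measures
   attaining one of the values +oo and -oo. *)
Definition signed_measure (B : set_system T) (nu : set T -> \bar R) : Prop :=
  [/\ nu set0 = 0%E,
      (forall A, B A -> nu A <> +oo%E) \/ (forall A, B A -> nu A <> -oo%E)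
    & forall A : nat -> set T, (forall n, B (A n)) -> trivIset setT A ->
        (\sum_(0 <= k < n) nu (A k))%E @[n --> \oo] --> nu (\bigcup_n A n)].

End SignedMeasure.

Section MeasureInducing.
Context {R : realType} {d : nat}.
Implicit Types (f g h : 'rV[R]_d -> R) (a b x y : 'rV[R]_d).

(* D_{x,y}[f] = l; the limit variables are delta_i = inl i and
   epsilon_i = inr i, and all orders of the 2d limits must give l. *)
Definition is_D f x y (l : R) : Prop :=
  forall s : seq ('I_d + 'I_d), perm_eq s (enum {: 'I_d + 'I_d}) ->
    iter_lim (fun=> 0) s
      (fun p => Delta (\row_i Num.max 0 (x 0 i - p (inl i)))
                      (\row_i (y 0 i + p (inr i))) f)
      (fun=> 0) l.

Definition measure_inducing f : Prop :=
  exists2 nu : set 'rV[R]_d -> \bar R, signed_measure borel_orthant nu &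
    forall x y, orthant x -> vle x y ->
      exists2 l : R, is_D f x y l & nu (box x y) = l%:E.

(* Lower I-marginal at the corner a, as a function on R^d that ignores the
   coordinates outside I.  Its value is the limit common to all orders of the
   coordinates outside I (0 if there is none). *)
Definition lower_marginal a (I : {set 'I_d}) f x : R :=
  xget 0 [set l : R | forall s : seq 'I_d, perm_eq s (enum (~: I)%SET) ->
    iter_lim (fun i => a 0 i) s (fun p => f (\row_i p i)) (fun i => x 0 i) l].

Definition F_ f x : R :=
  f x - \sum_(I : {set 'I_d} | I \proper [set: 'I_d]%SET)
          (-1) ^+ (d - #|I| - 1)%N * lower_marginal 0 I f x.

Definition product_partition a b (I : {set 'I_d}) (P : 'I_d -> seq R) : Prop :=
  forall i, i \in I -> itv_partition (a 0 i) (b 0 i) (P i).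

(* P i lists the points of a partition of [a_i, b_i] without its first point
   a_i, as in [itv_partition].  A box of the product partition of
   prod_{i in I} [a_i, b_i] is given by the position k i of its i-th side;
   k is 0 outside I. *)
Definition partition_sum a (I : {set 'I_d}) (P : 'I_d -> seq R) f : R :=
  \sum_(k : {ffun 'I_d -> 'I_(\max_i size (P i)).+1}
       | k \in pfamily ord0 (mem I) (fun i => [pred n : 'I__ | (n < size (P i))%N]))
    `| Delta_on I (\row_i nth 0 (a 0 i :: P i) (k i))
                  (\row_i nth 0 (a 0 i :: P i) (k i).+1)
                  (lower_marginal a I f) |.

(* Hardy-Krause variation of f on [a, b].  When a_j < b_j the limit
   x_j -> a_j+ only depends on f on [a, b]; when a_j = b_j nothing in [a, b]
   lies above a_j and the limit is taken in the domain of f (for right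
   continuous f it is the value of f at x_j = a_j). *)
Definition VarHK a b f : \bar R :=
  (\sum_(I : {set 'I_d} | I != finset.set0)
     ereal_sup [set (partition_sum a I P f)%:E
               | P in [set P : 'I_d -> seq R | product_partition a b I P]])%E.

Definition generates_signed_measure (F : 'rV[R]_d -> R) : Prop :=
  exists2 nu : set 'rV[R]_d -> \bar R, signed_measure borel_orthant nu &
    forall x, orthant x -> nu (box 0 x) = (F x)%:E.

Definition Delta_decomposition f g h : Prop :=
  forall x y, orthant x -> vle x y -> Delta x y f = Delta x y g - Delta x y h.

Definition jordan_decomposition f g h : Prop :=
  [/\ [/\ grounded g, component_right_continuous g & Delta_monotone g],
      [/\ grounded h, component_right_continuous h & Delta_monotone h],
      bounded_on_orthant g \/ bounded_on_orthant h,
      g 0 = 0 /\ h 0 = 0 &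
      [/\ forall x, orthant x -> F_ f x = g x - h x,
          forall x, orthant x ->
            VarHK 0%R x (F_ f) = (VarHK 0%R x g + VarHK 0%R x h)%E /\
            (VarHK 0%R x g + VarHK 0%R x h < +oo)%E
        & Delta_decomposition f g h]].

End MeasureInducing.

(* Main.v *)
(** Right-continuity turns the lower marginals at 0 into restrictions to the
    faces, so F^f(x) is the box increment of f over [0, x], and the increments
    of f and F^f agree on all boxes. Everything is phrased with additive
    functions of half-open boxes.

    (i) => (ii): all the limits in D_{0,x}[f] are trivial or right limits, so
    D_{0,x}[f] = F^f(x).

    (ii) => (iii): on a bounded region the signed measure is dominated by a
    finite measure (Hahn decomposition), hence the variation V of the box
    function phi = Delta f over finite grids is finite, additive and
    right-continuous; g = (V + phi)/2 and h = (V - phi)/2. If nu omits -oo but h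
    were unbounded, disjoint bounded sets of measure at most -1 would produce a
    set of measure -oo. For a grounded Delta-monotone g the Hardy-Krause
    variation on [0, x] is g(x), which gives uniqueness.

    (iv) => (i): the increments of g (and h) generate an outer measure for which
    half-spaces are Caratheodory measurable because boxes split additively along
    hyperplanes; compactness and right-continuity show that it extends the
    increments, and D_{x,y} is computed by continuity from above. *)

Require Import Defs.
From HB Require Import structures.
From mathcomp Require Import all_boot all_order all_algebra.
From mathcomp Require Import all_classical all_reals all_analysis.
From mathcomp Require Import ring lra.

Set Implicit Arguments.
Unset Strict Implicit.
Unset Printing Implicit Defensive.

Import Order.TTheory GRing.Theory Num.Theory.
Import numFieldNormedType.Exports.

Local Open Scope classical_set_scope.
Local Open Scope ring_scope.

(** * Coordinates and difference operators *)

Section Coordinates.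
Context {R : realType} {d : nat}.
Implicit Types (x y z a : 'rV[R]_d) (i j : 'I_d) (t u : R).

(** A hyperplane cuts a half-open box into exactly two such boxes, while closed boxes overlap. The
    price is that half-open boxes in the orthant miss the faces z_i = 0. In (iv) => (i) this is
    harmless: the measures are built to vanish on the faces, as F^f does. In (ii) => (iii) the
    closed boxes [0,x] are recovered by starting half-open boxes at the corner (-1,...,-1), and for
    this reason additivity carries a base point [a]. Grids are lists of hyperplanes, not families of
    partition points: a common refinement is then a concatenation, and additivity of the variation
    is an induction on lists. Product partitions enter only when the variation is compared with
    [VarHK]. The central notion is a content: nonnegative, additive on boxes, and small on thin
    slabs. It covers the dominating measures, the variations and the increments of g and h alike.
    Domination by a content is the only analytic input on the variation; it provides both the finite
    suprema and the right-continuity. *)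

Lemma set_coordE x i t j :
  set_coord x i t 0 j = if j == i then t else x 0 j.
Proof. by rewrite mxE. Qed.

Lemma set_coord_same x i t : set_coord x i t 0 i = t.
Proof. by rewrite set_coordE eqxx. Qed.

Lemma set_coord_neq x i t j : j != i -> set_coord x i t 0 j = x 0 j.
Proof. by rewrite set_coordE => /negbTE->. Qed.

Lemma set_coord_id x i : set_coord x i (x 0 i) = x.
Proof. by apply/rowP => j; rewrite set_coordE; case: eqP => [->|]. Qed.

Lemma set_coord_twice x i t u : set_coord (set_coord x i t) i u = set_coord x i u.
Proof. by apply/rowP => j; rewrite !set_coordE; case: eqP. Qed.

Lemma set_coordC x i j t u : i != j ->
  set_coord (set_coord x i t) j u = set_coord (set_coord x j u) i t.
Proof.
move=> ij; apply/rowP => k; rewrite !set_coordE.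
by have [->|//] := eqVneq k j; rewrite eq_sym (negbTE ij).
Qed.

Lemma add_deltaE x i t : x + t *: delta_mx 0 i = set_coord x i (x 0 i + t).
Proof.
apply/rowP => j; rewrite set_coordE !mxE eqxx/=.
by case: eqP => [->|_]; rewrite ?mulr1 ?mulr0 ?addr0.
Qed.

Lemma vle_refl x : vle x x. Proof. by move=> i. Qed.

Lemma vle_trans y x z : vle x y -> vle y z -> vle x z.
Proof. by move=> xy yz i; exact: le_trans (xy i) (yz i). Qed.

Lemma vle_set_coord x y i t u : vle x y -> t <= u ->
  vle (set_coord x i t) (set_coord y i u).
Proof. by move=> xy tu j; rewrite !set_coordE; case: eqP. Qed.

Lemma vle_set_coordl x y i t : vle x y -> t <= y 0 i -> vle (set_coord x i t) y.
Proof. by move=> xy ty; rewrite -[y](set_coord_id y i); exact: vle_set_coord. Qed.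

Lemma vle_set_coordr x y i t : vle x y -> x 0 i <= t -> vle x (set_coord y i t).
Proof. by move=> xy ty; rewrite -[x](set_coord_id x i); exact: vle_set_coord. Qed.

Lemma orthant_ge0 x i : orthant x -> 0 <= x 0 i.
Proof. by move=> /(_ i); rewrite mxE. Qed.

Lemma orthantP x : (forall i, 0 <= x 0 i) -> orthant x.
Proof. by move=> x0 i; rewrite mxE. Qed.

Lemma orthant0 : orthant (0 : 'rV[R]_d).
Proof. exact: vle_refl. Qed.

Lemma orthant_set_coord x i t : orthant x -> 0 <= t -> orthant (set_coord x i t).
Proof. by move=> x0 t0; apply: vle_set_coordr => //; rewrite mxE. Qed.

End Coordinates.

Section Differences.
Context {R : realType} {d : nat}.
Implicit Types (f g : 'rV[R]_d -> R) (x y z e a b : 'rV[R]_d).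
Implicit Types (i j : 'I_d) (s : seq 'I_d) (t : R).

Lemma iter_diff_cons i s e f x : iter_diff (i :: s) e f x =
  iter_diff s e f (set_coord x i (x 0 i + e 0 i)) - iter_diff s e f x.
Proof. by rewrite /= /diff_op add_deltaE. Qed.

Lemma eq_in_iter_diff s e e' f x : {in s, forall i, e 0 i = e' 0 i} ->
  iter_diff s e f x = iter_diff s e' f x.
Proof.
elim: s x => // i s IH x ee'; rewrite !iter_diff_cons ee' ?mem_head//.
by rewrite !IH// => j js; apply: ee'; rewrite inE js orbT.
Qed.

Lemma eq_iter_diff a s e f g x : (forall z, vle a z -> f z = g z) ->
  {in s, forall i, 0 <= e 0 i} -> vle a x -> iter_diff s e f x = iter_diff s e g x.
Proof.
move=> fg; elim: s x => [|i s IH] x e0 ax; first exact: fg.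
have e0' : {in s, forall j, 0 <= e 0 j} by move=> j js; rewrite e0// inE js orbT.
have axi : vle a (set_coord x i (x 0 i + e 0 i)).
  by apply: vle_set_coordr => //; apply: (le_trans (ax i)); rewrite lerDl e0 ?mem_head.
by rewrite !iter_diff_cons !IH.
Qed.

Lemma iter_diffB s e f g x :
  iter_diff s e (fun z => f z - g z) x = iter_diff s e f x - iter_diff s e g x.
Proof. by elim: s x => // i s IH x; rewrite !iter_diff_cons !IH; ring. Qed.

Lemma iter_diff_swap i j s e f x :
  iter_diff (i :: j :: s) e f x = iter_diff (j :: i :: s) e f x.
Proof.
have [->//|ij] := eqVneq i j.
have ji : j != i by rewrite eq_sym.
by rewrite !iter_diff_cons !set_coord_neq// (set_coordC _ _ _ ij); ring.
Qed.

Lemma iter_diff_rem i s e f x : i \in s ->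
  iter_diff s e f x = iter_diff (i :: rem i s) e f x.
Proof.
elim: s x => // j s IH x; rewrite inE; have [->|ij] := eqVneq i j; first by rewrite [rem _ _]/= eqxx.
rewrite orFb => is_.
rewrite [rem _ _]/= eq_sym (negbTE ij) iter_diff_cons !IH//.
by rewrite -iter_diff_swap -iter_diff_cons.
Qed.

Lemma Delta_on_coord (I : {set 'I_d}) i x y f : i \in I ->
  let D := iter_diff (rem i (enum I)) (y - x) f in
  Delta_on I x y f = D (set_coord x i (y 0 i)) - D (set_coord x i (x 0 i)).
Proof.
move=> iI /=; rewrite /Delta_on (iter_diff_rem _ _ _ (_ : i \in enum I)) ?mem_enum//.
by rewrite iter_diff_cons !mxE subrKC set_coord_id.
Qed.

(** Once direction [i] is brought to the front, all three terms are differences of one function of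
    the [i]-th coordinate, and these telescope through [t], wherever [t] lies. *)
Lemma Delta_on_split (I : {set 'I_d}) i x y t f : i \in I ->
  Delta_on I x y f =
  Delta_on I x (set_coord y i t) f + Delta_on I (set_coord x i t) y f.
Proof.
move=> iI; rewrite !(Delta_on_coord _ _ _ iI) !set_coord_same !set_coord_twice.
set s := rem i _.
have e1 z : iter_diff s (set_coord y i t - x) f z = iter_diff s (y - x) f z.
  apply: eq_in_iter_diff => j; rewrite mem_rem_uniq ?enum_uniq// => /andP[/negbTE ji _].
  by rewrite !mxE ji.
have e2 z : iter_diff s (y - set_coord x i t) f z = iter_diff s (y - x) f z.
  apply: eq_in_iter_diff => j; rewrite mem_rem_uniq ?enum_uniq// => /andP[/negbTE ji _].
  by rewrite !mxE ji.
by rewrite !e1 !e2 set_coord_id; ring.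
Qed.

Lemma eq_Delta_on a (I : {set 'I_d}) x y f g : (forall z, vle a z -> f z = g z) ->
  vle a x -> vle x y -> Delta_on I x y f = Delta_on I x y g.
Proof.
move=> fg ax xy; apply: (eq_iter_diff (a := a)) => // i _.
by rewrite !mxE subr_ge0.
Qed.

(** The corners of the difference move only in the directions of [s], so coordinate [i] stays free
    and every corner is approached from the right along it. *)
Lemma iter_diff_rcont s e f x i : component_right_continuous f -> i \notin s ->
  orthant x -> {in s, forall j, 0 <= e 0 j} ->
  iter_diff s e f (set_coord x i t) @[t --> (x 0 i)^'+] --> iter_diff s e f x.
Proof.
move=> rf; elim: s x => [|j s IH] x; first by move=> _ x0 _; exact: rf.
rewrite inE negb_or => /andP[ij is_] x0 e0; rewrite iter_diff_cons.
have e0' : {in s, forall j, 0 <= e 0 j} by move=> k ks; rewrite e0// inE ks orbT.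
have x1 : orthant (set_coord x j (x 0 j + e 0 j)).
  by apply: orthant_set_coord => //; rewrite addr_ge0 ?(orthant_ge0 _ x0) ?e0 ?mem_head.
have ji : j != i by rewrite eq_sym.
under eq_fun do rewrite iter_diff_cons set_coordC// set_coord_neq//.
apply: cvgB; last exact: IH.
by have := IH _ is_ x1 e0'; rewrite set_coord_neq.
Qed.

Lemma iter_diff_bound s e f (M : R) x : (forall z, orthant z -> `|f z| <= M) ->
  orthant x -> {in s, forall j, 0 <= e 0 j} ->
  `|iter_diff s e f x| <= 2 ^+ size s * M.
Proof.
move=> fM; elim: s x => [|i s IH] x x0 e0; first by rewrite expr0 mul1r fM.
rewrite iter_diff_cons (le_trans (ler_normB _ _))//= exprS.
have e0' : {in s, forall j, 0 <= e 0 j} by move=> j js; rewrite e0// inE js orbT.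
have xi : orthant (set_coord x i (x 0 i + e 0 i)).
  by apply: orthant_set_coord => //; rewrite addr_ge0 ?(orthant_ge0 _ x0) ?e0 ?mem_head.
by rewrite -mulrA mulr2n mulrDl !mul1r lerD ?IH.
Qed.

Lemma iter_diff_sum s e f x : uniq s -> iter_diff s e f x =
  \sum_(J : {set 'I_d} | J \subset [set i in s]%SET)
    (-1) ^+ (size s - #|J|) *
    f (\row_i (if i \in J then x 0 i + e 0 i else x 0 i)).
Proof.
elim: s x => [|i s IH] x.
  move=> _; rewrite (big_pred1 finset.set0) => [|J]; last first.
    apply/idP/eqP => [/fintype.subsetP Js|->]; last by rewrite finset.sub0set.
    by apply/finset.setP => i; rewrite inE; apply/negP => /Js; rewrite inE.
  by rewrite cards0 subn0 mul1r/=; congr f; apply/rowP => i; rewrite mxE inE.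
rewrite cons_uniq => /andP[is_ us]; rewrite iter_diff_cons !IH//.
(* The subsets containing [i] give the shifted term and are reindexed by removing [i]. The others
   give the unshifted term, whose minus sign comes from the list being longer by one. *)
rewrite [RHS](bigID (fun J : {set 'I_d} => i \in J))/= -sumrN; congr (_ + _).
  rewrite [RHS](reindex_onto (fun J : {set 'I_d} => i |: J)%SET (fun J => J :\ i)%SET)/=; last first.
    by move=> J /andP[_ iJ]; rewrite finset.setD1K.
  apply: eq_big => [J|J Js].
    rewrite !inE eqxx andbT /=; apply/idP/idP => [Js|/andP[Js /eqP JE]].
      have iJ : i \notin J by apply: contra is_ => /(fintype.subsetP Js); rewrite inE.
      rewrite finset.setU1K// eqxx andbT; apply/fintype.subsetP => j.
      by rewrite !inE => /predU1P[->|/(fintype.subsetP Js)]; rewrite ?eqxx// inE => ->; rewrite orbT.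
    apply/fintype.subsetP => j jJ; have : j \in (i |: J)%SET by rewrite inE jJ orbT.
    move/(fintype.subsetP Js); rewrite !inE => /predU1P[ji|//].
    by move: jJ; rewrite -JE !inE ji eqxx.
  have iJ : i \notin J by apply: contra is_ => /(fintype.subsetP Js); rewrite inE.
  rewrite cardsU1 iJ add1n subSS; congr (_ * f _); apply/rowP => j.
  rewrite !mxE !inE; case: eqP => [->|//]; first by rewrite (negbTE iJ).
apply: eq_big => [J|J Js].
  apply/idP/andP => [Js|[Js iJ]].
    split; last by apply: contra is_ => /(fintype.subsetP Js); rewrite inE.
    by apply/fintype.subsetP => j /(fintype.subsetP Js); rewrite !inE => ->; rewrite orbT.
  apply/fintype.subsetP => j jJ; move/(fintype.subsetP Js): (jJ); rewrite !inE.
  by case/predU1P => [ji|//]; rewrite -ji jJ in iJ.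
have cJ : (#|J| <= size s)%N.
  by rewrite (leq_trans (subset_leq_card Js))// cardsE (card_uniqP us).
by rewrite subSn// exprS mulN1r mulNr.
Qed.

Lemma Delta_sum x y f : Delta x y f =
  \sum_(J : {set 'I_d}) (-1) ^+ (d - #|J|) *
    f (\row_i (if i \in J then y 0 i else x 0 i)).
Proof.
rewrite /Delta /Delta_on iter_diff_sum ?enum_uniq//.
rewrite -cardE cardsT card_ord; apply: eq_big => [J|J _].
  by apply/fintype.subsetP => j _; rewrite inE mem_enum inE.
by congr (_ * f _); apply/rowP => j; rewrite !mxE subrKC.
Qed.

Lemma Delta_split i x y t f :
  Delta x y f = Delta x (set_coord y i t) f + Delta (set_coord x i t) y f.
Proof. by apply: Delta_on_split; rewrite inE. Qed.

(** The box is a slab of thickness [t - x 0 i], and its increment is a difference of two values of a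
    function that is right-continuous in that coordinate. *)
Lemma Delta_coord_rcont f x y i : component_right_continuous f ->
  orthant x -> vle x y ->
  Delta x (set_coord y i t) f @[t --> (x 0 i)^'+] --> (0 : R).
Proof.
move=> rf x0 xy; set s := rem i (enum [set: 'I_d]%SET).
have is_ : i \notin s by rewrite mem_rem_uniq ?enum_uniq// inE eqxx.
rewrite -(subrr (iter_diff s (y - x) f x)).
have DE t : Delta x (set_coord y i t) f =
    iter_diff s (y - x) f (set_coord x i t) - iter_diff s (y - x) f x.
  rewrite /Delta (Delta_on_coord (i := i)) ?inE// set_coord_same set_coord_id.
  congr (_ - _); apply: eq_in_iter_diff => j js; rewrite !mxE;
    by case: eqP => // ji; rewrite -ji js in is_.
under eq_fun do rewrite DE.
apply: cvgB; last exact: cvg_cst.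
apply: iter_diff_rcont => // j _; by rewrite !mxE subr_ge0.
Qed.

End Differences.

(** * Iterated limits and lower marginals *)

Section IteratedLimits.
Context {R : realType} {V : eqType}.
Implicit Types (c p q : V -> R) (v w : V) (s : seq V) (G H : (V -> R) -> R).

Lemma iter_lim_unique c s G p l m :
  iter_lim c s G p l -> iter_lim c s G p m -> l = m.
Proof.
elim: s p l m => [|v s IH] p l m /=; first by move=> -> ->.
move=> [phi [Hphi phil]] [psi [Hpsi psim]].
suff psil : psi t @[t --> (c v)^'+] --> l by exact: (cvg_unique _ psil psim).
apply: cvg_trans phil; apply: near_eq_cvg; near=> t; apply: (IH (assign p v t)); near: t; [exact: Hphi|exact: Hpsi].
Unshelve. all: by end_near. Qed.

(** Right-continuity above [c] evaluates each one-variable limit by substitution. The condition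
    [c w <= q w] survives because every limit variable stays to the right of its limit point. *)
Lemma iter_lim_rcont c s G p : uniq s ->
  (forall q v, (forall w, c w <= q w) ->
    G (assign q v t) @[t --> (c v)^'+] --> G (assign q v (c v))) ->
  (forall w, c w <= p w) ->
  iter_lim c s G p (G (fun w => if w \in s then c w else p w)).
Proof.
move=> us rG; elim: s p us => [//|v s IH] p /= /andP[vs us] cp.
exists (fun t => G (fun w => if w \in s then c w else assign p v t w)); split.
  near=> t; apply: IH => // w; rewrite /assign; case: eqP => [->|_]; last exact: cp.
  by apply: ltW; near: t; exact: nbhs_right_gt.
set q := fun w => if w \in s then c w else p w.
have qE t : (fun w => if w \in s then c w else assign p v t w) = assign q v t.
  apply: funext => w; rewrite /assign /q; case: ifP => // ws.
  by case: eqP => // wv; rewrite -wv ws in vs.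
have -> : (fun w => if w \in v :: s then c w else p w) = assign q v (c v).
  by apply: funext => w; rewrite /assign /q inE; have [->|] := eqVneq w v.
rewrite (_ : (fun t => G _) = fun t => G (assign q v t)); last by apply: funext => t; rewrite qE.
apply: rG => w; rewrite /q; case: ifP => // _; exact: cp.
Unshelve. all: by end_near. Qed.

Lemma iter_limB c s G H p l m : iter_lim c s G p l -> iter_lim c s H p m ->
  iter_lim c s (fun q => G q - H q) p (l - m).
Proof.
elim: s p l m => [|v s IH] p l m /=; first by move=> -> ->.
move=> [phi [Hphi phil]] [psi [Hpsi psim]]; exists (fun t => phi t - psi t); split.
  near=> t; apply: IH; near: t; [exact: Hphi|exact: Hpsi].
exact: cvgB.
Unshelve. all: by end_near. Qed.

Lemma eq_iter_lim c s G H p l : (forall q, (forall w, c w <= q w) -> G q = H q) ->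
  (forall w, c w <= p w) -> iter_lim c s G p l -> iter_lim c s H p l.
Proof.
move=> GH; elim: s p l => [|v s IH] p l cp /=; first by rewrite GH.
move=> [phi [Hphi phil]]; exists phi; split => //; near=> t.
apply: IH; last by near: t; exact: Hphi.
move=> w; rewrite /assign; case: eqP => [->|_]; last exact: cp.
by apply: ltW; near: t; exact: nbhs_right_gt.
Unshelve. all: by end_near. Qed.

End IteratedLimits.

(** * Lower marginals at 0, and the operator D at the origin *)

Section Marginals.
Context {R : realType} {d : nat}.
Implicit Types (f g : 'rV[R]_d -> R) (x y z : 'rV[R]_d).

Lemma lower_marginalE f (I : {set 'I_d}) x :
  component_right_continuous f -> orthant x ->
  lower_marginal 0 I f x = f (\row_i (if i \in I then x 0 i else 0)).
Proof.
move=> rf x0; set l := RHS.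
have lP : forall s : seq 'I_d, perm_eq s (enum (~: I)%SET) ->
    iter_lim (fun i => (0 : 'rV[R]_d) 0 i) s (fun p => f (\row_i p i)) (fun i => x 0 i) l.
  move=> s ps; pose c (i : 'I_d) := (0 : 'rV[R]_d) 0 i.
  pose G (p : 'I_d -> R) := f (\row_i p i).
  have -> : l = G (fun i => if i \in s then c i else x 0 i).
    rewrite /G /l; congr f; apply/rowP => i; rewrite !mxE (perm_mem ps) mem_enum.
    by rewrite inE /c mxE; case: ifP.
  apply: iter_lim_rcont => //.
    by rewrite (perm_uniq ps) enum_uniq.
  move=> q v cq; rewrite /G.
  have qE t : (\row_i assign q v t i) = set_coord (\row_i assign q v (c v) i) v t.
    by apply/rowP => i; rewrite !mxE /assign; case: eqP.
  under eq_fun do rewrite qE.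
  have zv : (\row_i assign q v (c v) i) 0 v = c v by rewrite mxE /assign eqxx.
  have := rf (\row_i assign q v (c v) i) v; rewrite zv; apply.
  move=> i; rewrite !mxE /assign; case: eqP => _; first by rewrite /c mxE.
  by have := cq i; rewrite /c mxE.
rewrite /lower_marginal; case: xgetP => [m _ mP|/(_ l)]; last by move/(_ lP).
by apply: iter_lim_unique (mP _ (perm_refl _)) (lP _ (perm_refl _)).
Qed.

Lemma F_E f x : component_right_continuous f -> orthant x -> F_ f x = Delta 0 x f.
Proof.
move=> rf x0; rewrite /F_ Delta_sum [RHS](bigD1 [set: 'I_d]%SET)//=.
congr (_ + _).
  rewrite cardsT card_ord subnn expr0 mul1r; congr f; apply/rowP => i.
  by rewrite mxE inE.
rewrite -sumrN; apply: eq_big => [I|I]; first by rewrite finset.properT.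
rewrite finset.properT => IT; rewrite lower_marginalE// -mulNr; congr (_ * f _).
  (* The exponent [d - #|I| - 1] is a truncated subtraction. As [I] is proper, it is one less than
     the exponent in the corner sum, and the minus sign in [F_] makes up for it. *)
  have dI : (#|I| < d)%N.
    rewrite -[X in (_ < X)%N](card_ord d) -cardsT proper_card// finset.properT//.
  by rewrite -{2}(subnK (_ : 1 <= d - #|I|)%N) ?subn_gt0// addn1 exprS mulN1r.
by apply/rowP => i; rewrite !mxE.
Qed.

Lemma cvg_at_right_shift (g : R -> R) (a l : R) :
  g t @[t --> a^'+] --> l -> g (a + t) @[t --> 0^'+] --> l.
Proof.
move=> /cvg_at_rightP gl; apply/cvg_at_rightP => u [u0 ul].
apply: (gl (fun n => a + u n)); split=> [n|]; first by rewrite ltrDl u0.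
by rewrite -[X in _ --> X]addr0; apply: cvgD => //; exact: cvg_cst.
Qed.

Lemma Delta_rcont_upper f x y i : component_right_continuous f ->
  orthant x -> vle x y ->
  Delta x (set_coord y i t) f @[t --> (y 0 i)^'+] --> Delta x y f.
Proof.
move=> rf x0 xy; rewrite -[X in _ --> X]addr0.
have DE t : Delta x (set_coord y i t) f =
    Delta x y f + Delta (set_coord x i (y 0 i)) (set_coord y i t) f.
  by rewrite (Delta_split i _ _ (y 0 i)) set_coord_twice set_coord_id.
under eq_fun do rewrite DE.
apply: cvgD; first exact: cvg_cst.
have := @Delta_coord_rcont _ _ f (set_coord x i (y 0 i)) y i rf.
rewrite set_coord_same; apply; last exact: vle_set_coordl.
by apply: orthant_set_coord => //; exact: le_trans (orthant_ge0 _ x0) (xy i).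
Qed.

Lemma is_D_origin f y : component_right_continuous f -> orthant y ->
  is_D f 0 y (F_ f y).
Proof.
move=> rf y0 s ps.
pose G (p : 'I_d + 'I_d -> R) := Delta (\row_i Num.max 0 ((0 : 'rV[R]_d) 0 i - p (inl i)))
  (\row_i (y 0 i + p (inr i))) f.
pose c (_ : 'I_d + 'I_d) := 0 : R.
rewrite F_E//.
have -> : Delta 0 y f = G (fun w => if w \in s then c w else c w).
  rewrite /G; congr Delta; apply/rowP => i; rewrite !mxE if_same /c.
    by rewrite subr0 maxxx.
  by rewrite addr0.
apply: iter_lim_rcont => //; first by rewrite (perm_uniq ps) enum_uniq.
move=> q v cq; rewrite /G /c /=.
have E0 p : (forall i, 0 <= p (inl i)) ->
    \row_i Num.max 0 ((0 : 'rV[R]_d) 0 i - p (inl i)) = 0.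
  by move=> p0; apply/rowP => i; rewrite !mxE sub0r; apply/max_idPl; rewrite oppr_le0.
rewrite [X in Delta X]E0; last first.
  by move=> i; rewrite /assign; case: eqP => // _; exact: cq.
pose z := \row_i (y 0 i + assign q v 0 (inr i)).
have z0 : orthant z.
  apply: orthantP => i; rewrite mxE addr_ge0 ?orthant_ge0//.
  by rewrite /assign; case: eqP => // _; exact: cq.
pose z_ t := \row_i (y 0 i + assign q v t (inr i)).
suff H : Delta 0 (z_ t) f @[t --> 0^'+] --> Delta 0 z f.
  apply: cvg_trans H; apply: near_eq_cvg; near=> t; rewrite E0// => i.
  rewrite /assign; case: eqP => [_|_]; last exact: cq.
  by apply: ltW; near: t; exact: nbhs_right_gt.
case: v @z z0 @z_ => i z z0 z_.
  have -> : z_ = fun=> z by apply: funext => t; apply/rowP => j; rewrite !mxE /assign.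
  exact: cvg_cst.
have -> : z_ = fun t => set_coord z i (z 0 i + t).
  apply: funext => t; apply/rowP => j; rewrite !mxE /assign.
  have rE k : (inr k == inr i :> 'I_d + 'I_d) = (k == i) by [].
  by rewrite !rE; case: eqP => [->|//]; rewrite ?eqxx ?addr0.
apply: (@cvg_at_right_shift (fun t => Delta 0 (set_coord z i t) f)).
exact: Delta_rcont_upper.
Unshelve. all: by end_near. Qed.

Lemma measure_inducing_generates f : component_right_continuous f ->
  measure_inducing f -> generates_signed_measure (F_ f).
Proof.
move=> rf [nu nus nuD]; exists nu => // x x0.
have [l Dl ->] := nuD 0 x orthant0 x0; congr EFin.
exact: iter_lim_unique (Dl _ (perm_refl _)) (is_D_origin rf x0 (perm_refl _)).
Qed.

End Marginals.

(** * Additive box functions and contents *)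

Section BoxFunctions.
Context {R : realType} {d : nat}.
Implicit Types (x y z a b u v e N : 'rV[R]_d) (c phi : 'rV[R]_d -> 'rV[R]_d -> R).
Implicit Types (i j : 'I_d) (s : seq 'I_d) (t : R).

(** The base point [a] bounds the boxes from below: it is 0 for functions on the orthant, and has
    negative coordinates where half-open boxes must contain points of the faces. *)
Definition box_additive a c := forall x y i t,
  vle a x -> vle x y -> x 0 i <= t <= y 0 i ->
  c x y = c x (set_coord y i t) + c (set_coord x i t) y.

(** The values on half-open boxes of a measure finite on bounded sets. Continuity is asked only for
    slabs shrinking to the empty set; additivity carries it to the upper corners. *)
Record box_content a c := BoxContent {
  content_ge0 : forall x y, vle a x -> vle x y -> 0 <= c x y ;
  content_add : box_additive a c ;
  content_rcont : forall x y i, vle a x -> vle x y ->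
    c x (set_coord y i t) @[t --> (x 0 i)^'+] --> (0 : R) }.

(** Cutting at [y 0 i] returns the same degenerate box twice, so its value is twice itself. *)
Lemma box_additive_degenerate a c x y i : box_additive a c ->
  vle a x -> vle x y -> x 0 i = y 0 i -> c x y = 0.
Proof.
move=> cadd ax xy xyi; have := cadd x y i (y 0 i) ax xy.
rewrite xy lexx set_coord_id -{1}xyi set_coord_id => /(_ isT) /eqP.
by rewrite -subr_eq subrr eq_sym => /eqP.
Qed.

(** [c a] is the distribution function of [c]. A difference in direction [i] removes the part below
    [z 0 i], which moves the lower side from [a] to [z] there. A full [s] recovers [c]; a partial
    one gives monotonicity of lower order. *)
Lemma iter_diff_base a c s e z : box_additive a c -> uniq s -> vle a z ->
  {in s, forall i, 0 <= e 0 i} ->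
  iter_diff s e (c a) z = c (\row_i (if i \in s then z 0 i else a 0 i))
                            (\row_i (if i \in s then z 0 i + e 0 i else z 0 i)).
Proof.
move=> cadd; elim: s z => [|i s IH] z.
  by move=> _ _ _ /=; congr (c _ _); apply/rowP => i; rewrite mxE.
rewrite cons_uniq => /andP[is_ us] az e0.
have e0' : {in s, forall j, 0 <= e 0 j} by move=> j js; rewrite e0// inE js orbT.
have ei : 0 <= e 0 i by rewrite e0 ?mem_head.
have azi : vle a (set_coord z i (z 0 i + e 0 i)).
  by apply: vle_set_coordr => //; rewrite (le_trans (az i))// lerDl.
rewrite iter_diff_cons !IH//.
set lo := \row_j (if j \in s then z 0 j else a 0 j).
set hi := \row_j (if j \in s then z 0 j + e 0 j else z 0 j).
have -> : \row_j (if j \in s then (set_coord z i (z 0 i + e 0 i)) 0 j else a 0 j) = lo.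
  apply/rowP => j; rewrite !mxE; case: ifP => // js; case: eqP => // ji.
  by rewrite -ji js in is_.
have -> : \row_j (if j \in s then (set_coord z i (z 0 i + e 0 i)) 0 j + e 0 j
    else (set_coord z i (z 0 i + e 0 i)) 0 j) = set_coord hi i (z 0 i + e 0 i).
  apply/rowP => j; rewrite !mxE; case: eqP => [->|//]; by rewrite (negbTE is_).
have -> : \row_j (if j \in i :: s then z 0 j else a 0 j) = set_coord lo i (z 0 i).
  by apply/rowP => j; rewrite !mxE inE; case: eqP => [->|//].
have -> : \row_j (if j \in i :: s then z 0 j + e 0 j else z 0 j) =
    set_coord hi i (z 0 i + e 0 i).
  by apply/rowP => j; rewrite !mxE inE; case: eqP => [->|//].
have loi : lo 0 i = a 0 i by rewrite mxE (negbTE is_).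
have hii : hi 0 i = z 0 i by rewrite mxE (negbTE is_).
have lohi : vle lo hi.
  move=> j; rewrite !mxE; case: ifP => [js|_]; last exact: az.
  by rewrite lerDl e0'.
rewrite (cadd lo _ i (z 0 i)).
- by rewrite set_coord_twice -{1}hii set_coord_id; ring.
- by move=> j; rewrite mxE; case: ifP => [js|_]; [exact: az|exact: lexx].
- by apply: vle_set_coordr => //; rewrite loi (le_trans (az i))// lerDl.
- by rewrite loi set_coord_same az/= lerDl.
Qed.

Lemma Delta_base a c x y : box_additive a c -> vle a x -> vle x y ->
  Delta x y (c a) = c x y.
Proof.
move=> cadd ax xy; rewrite /Delta /Delta_on iter_diff_base ?enum_uniq//.
  by congr (c _ _); apply/rowP => i; rewrite !mxE mem_enum inE ?subrKC.
by move=> i _; rewrite !mxE subr_ge0.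
Qed.

Lemma Delta_additive a (f : 'rV[R]_d -> R) : box_additive a (fun x y => Delta x y f).
Proof. by move=> x y i t _ _ _; exact: Delta_split. Qed.

Lemma box_additiveD a c c' : box_additive a c -> box_additive a c' ->
  box_additive a (fun x y => c x y + c' x y).
Proof. by move=> ca c'a x y i t *; rewrite (ca x y i t)// (c'a x y i t)//; ring. Qed.

Lemma box_additiveZ a c (k : R) : box_additive a c ->
  box_additive a (fun x y => k * c x y).
Proof. by move=> ca x y i t *; rewrite (ca x y i t)//; ring. Qed.

Lemma content_le a c x y x' y' : box_additive a c ->
  (forall x y, vle a x -> vle x y -> 0 <= c x y) ->
  vle a x -> vle x x' -> vle x' y' -> vle y' y -> c x' y' <= c x y.
Proof.
move=> cadd c0 ax xx' x'y' y'y.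
(* Interpolates from [u] to [v] one direction at a time, so that each step drops one nonnegative
   piece. *)
pose mix s u v := \row_i (if i \in s then v 0 i else u 0 i : R).
have mixE s i u v : mix (i :: s) u v = set_coord (mix s u v) i (v 0 i).
  by apply/rowP => j; rewrite !mxE inE; case: eqP => [->|].
have mixT u v : mix (enum 'I_d) u v = v.
  by apply/rowP => j; rewrite !mxE mem_enum.
have mixl s u v w : vle w u -> vle w v -> vle w (mix s u v).
  by move=> wu wv i; rewrite mxE; case: ifP.
have mixr s u v w : vle u w -> vle v w -> vle (mix s u v) w.
  by move=> wu wv i; rewrite mxE; case: ifP.
have x'y := vle_trans x'y' y'y; have xy := vle_trans xx' x'y.
have H1 s : c (mix s x x') y <= c x y.
  elim: s => [|i s IH].
    by rewrite (_ : mix [::] x x' = x)//; apply/rowP => j; rewrite mxE.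
  apply: le_trans IH; rewrite mixE.
  have am : vle a (mix s x x') by apply: mixl => //; exact: vle_trans ax xx'.
  have my : vle (mix s x x') y by exact: mixr.
  have mi : mix s x x' 0 i <= x' 0 i <= y 0 i.
    by rewrite x'y andbT mxE; case: ifP => // _; exact: xx'.
  rewrite (cadd _ _ _ _ am my mi) lerDr; apply: c0 => //.
  by case/andP: mi => mi _; apply: vle_set_coordr.
have ax' := vle_trans ax xx'.
have H2 s : c x' (mix s y y') <= c x' y.
  elim: s => [|i s IH].
    by rewrite (_ : mix [::] y y' = y)//; apply/rowP => j; rewrite mxE.
  apply: le_trans IH; rewrite mixE.
  have my : vle x' (mix s y y') by exact: mixl.
  have mi : x' 0 i <= y' 0 i <= mix s y y' 0 i.
    by rewrite x'y' mxE /=; case: ifP => // _; exact: y'y.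
  rewrite (cadd _ _ _ _ ax' my mi) lerDl; case/andP: mi => m1 m2.
  apply: c0; first by apply: (vle_trans ax'); apply: vle_set_coordr.
  by apply: vle_set_coordl.
by move: (H1 (enum 'I_d)) (H2 (enum 'I_d)); rewrite !mixT => ? /le_trans; apply.
Qed.

(** For [x <= y] and [u <= v], the half-open boxes from [u] to [v] and from [x] to [y] meet in the
    one from [clamp x y u] to [clamp x y v], which is degenerate if they are disjoint. *)
Definition clamp x y b := \row_i Num.min (Num.max (b 0 i) (x 0 i)) (y 0 i).

Lemma clamp_ge x y b : vle x y -> vle x (clamp x y b).
Proof. by move=> xy i; rewrite mxE le_min le_max lexx orbT/=; exact: xy. Qed.

Lemma le_clamp x y u v : vle u v -> vle (clamp x y u) (clamp x y v).
Proof.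
by move=> uv i; rewrite !mxE le_min2 ?le_max2.
Qed.

(** If the hyperplane misses the box, one of the two pieces is degenerate and has value 0; thus [t]
    may lie outside the box. *)
Lemma box_additive_minmax a c u v i t : box_additive a c -> vle a u -> vle u v ->
  a 0 i <= t ->
  c u v = c (set_coord u i (Num.min (u 0 i) t)) (set_coord v i (Num.min (v 0 i) t)) +
          c (set_coord u i (Num.max (u 0 i) t)) (set_coord v i (Num.max (v 0 i) t)).
Proof.
move=> cadd au uv ait; have uvi := uv i.
have atu : vle a (set_coord u i t) by apply: vle_set_coordr.
have tt : vle (set_coord u i t) (set_coord v i t) by apply: vle_set_coord.
have c0 : c (set_coord u i t) (set_coord v i t) = 0.
  by apply: (box_additive_degenerate (i := i) cadd); rewrite ?set_coord_same.
have [tu|ut] := leP t (u 0 i).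
  rewrite (min_idPr _) ?(le_trans tu)// (max_idPl _) ?(le_trans tu)//.
  by rewrite c0 add0r !set_coord_id.
have [vt|tv] := leP (v 0 i) t.
  by rewrite c0 addr0 !set_coord_id.
by rewrite !set_coord_id -(cadd u v i t)// (ltW ut) (ltW tv).
Qed.

Lemma clamp_additive a c u v : box_additive a c -> vle u v ->
  box_additive a (fun x y => c (clamp x y u) (clamp x y v)).
Proof.
move=> cadd uv x y i t ax xy /andP[xt ty].
rewrite (@box_additive_minmax a c (clamp x y u) (clamp x y v) i t)//.
- have El b : clamp x (set_coord y i t) b =
      set_coord (clamp x y b) i (Num.min (clamp x y b 0 i) t).
    apply/rowP => j; rewrite !mxE; case: eqP => [->|//].
    by rewrite -minA; congr Num.min; rewrite (min_idPr ty).
  have Er b : clamp (set_coord x i t) y b =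
      set_coord (clamp x y b) i (Num.max (clamp x y b 0 i) t).
    apply/rowP => j; rewrite !mxE; case: eqP => [->|//].
    by rewrite max_minl -maxA (max_idPr xt) (max_idPl ty).
  by rewrite !El !Er.
- exact: vle_trans (clamp_ge _ xy).
- exact: le_clamp.
- exact: le_trans (ax i) xt.
Qed.

(** Additivity lets a sign be checked on the cells of a finite grid, that is, on boxes crossed by no
    hyperplane of [L]. *)
Lemma cut_ge0 a phi (L : seq ('I_d * R)) x y : box_additive a phi ->
  vle a x -> vle x y ->
  (forall x' y', vle x x' -> vle x' y' -> vle y' y ->
    (forall p, p \in L -> p.2 <= x' 0 p.1 \/ y' 0 p.1 <= p.2) -> 0 <= phi x' y') ->
  0 <= phi x y.
Proof.
move=> padd; elim: L x y => [|[i t] L IH] x y ax xy H.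
  by apply: H => //; exact: vle_refl.
have [tx|xt] := leP t (x 0 i).
  apply: IH => // x' y' xx' x'y' y'y HL; apply: H => // p; rewrite inE.
  by case/predU1P => [->|/HL//]; left; exact: le_trans (xx' i).
have [yt|ty] := leP (y 0 i) t.
  apply: IH => // x' y' xx' x'y' y'y HL; apply: H => // p; rewrite inE.
  by case/predU1P => [->|/HL//]; right; exact: le_trans (y'y i) yt.
have [xt' ty'] := (ltW xt, ltW ty).
rewrite (padd x y i t) ?xt'//; apply: addr_ge0; apply: IH => //.
- by apply: vle_set_coordr.
- move=> x' y' xx' x'y' y'y HL; apply: H => //.
    by apply: (vle_trans y'y); apply: vle_set_coordl; [exact: vle_refl|].
  move=> p; rewrite inE => /predU1P[->|/HL//]; right.
  by apply: le_trans (y'y i) _; rewrite set_coord_same.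
- by apply: (vle_trans ax); apply: vle_set_coordr; [exact: vle_refl|].
- by apply: vle_set_coordl.
- move=> x' y' xx' x'y' y'y HL; apply: H => //.
    by apply: vle_trans xx'; apply: vle_set_coordr; [exact: vle_refl|].
  move=> p; rewrite inE => /predU1P[->|/HL//]; left.
  by apply: le_trans (xx' i); rewrite set_coord_same.
Qed.

Definition hob x y : set 'rV[R]_d := [set z | forall i, x 0 i < z 0 i <= y 0 i].

(** The excess of the clipped covering boxes over [c] is additive, so its sign is tested on cells
    crossed by no face of the cover. The covering box that contains the upper corner of such a cell
    contains the whole cell and already pays for it. *)
Lemma content_cover a c x y (s : seq ('rV[R]_d * 'rV[R]_d)) : box_additive a c ->
  (forall x y, vle a x -> vle x y -> 0 <= c x y) ->
  vle a x -> vle x y -> (forall p, p \in s -> vle a p.1 /\ vle p.1 p.2) ->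
  (forall z, hob x y z -> exists2 p, p \in s & hob p.1 p.2 z) ->
  c x y <= \sum_(p <- s) c p.1 p.2.
Proof.
move=> cadd c0 ax xy sP cov.
pose cl x y (p : 'rV[R]_d * 'rV[R]_d) := c (clamp x y p.1) (clamp x y p.2).
have cladd p : p \in s -> box_additive a (fun x y => cl x y p).
  by move=> /sP[_ p12]; apply: clamp_additive.
pose phi x y := \sum_(p <- s) cl x y p - c x y.
have phiadd : box_additive a phi.
  move=> u v i t au uv utv; rewrite /phi (cadd _ _ _ _ au uv utv).
  rewrite (eq_big_seq (fun p => cl u (set_coord v i t) p + cl (set_coord u i t) v p)).
    by rewrite big_split/=; ring.
  by move=> p ps; rewrite (cladd p ps _ _ _ _ au uv utv).
have le_cl p : p \in s -> cl x y p <= c p.1 p.2.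
  move=> ps; have [ap p12] := sP p ps.
  have axc : vle a (clamp x y p.1) by apply: vle_trans (clamp_ge _ xy).
  have p12c : vle (clamp x y p.1) (clamp x y p.2) by exact: le_clamp.
  (* A covering box lying beyond [y] or below [x] in some direction is clipped to a degenerate one;
     in the remaining case clipping only shrinks it. *)
  have [py|] := pselect (vle p.1 y); last first.
    move/existsNP => [i /negP]; rewrite -ltNge => ypi.
    rewrite /cl (@box_additive_degenerate a c _ _ i)// ?c0//.
    by rewrite !mxE !(min_idPr _)// le_max ?(ltW ypi)// (le_trans (ltW ypi))//; exact: p12.
  have [xp|] := pselect (vle x p.2); last first.
    move/existsNP => [i /negP]; rewrite -ltNge => pxi.
    rewrite /cl (@box_additive_degenerate a c _ _ i)// ?c0//.
    by rewrite !mxE !(max_idPr _)// ?(ltW pxi)// (le_trans (p12 i))// ltW.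
  apply: (content_le cadd c0 ap) => // i; rewrite mxE.
    by rewrite le_min le_max lexx/=; exact: py.
  by rewrite ge_min ge_max lexx/= xp.
suff : 0 <= phi x y.
  by rewrite subr_ge0 => /le_trans; apply; rewrite big_seq [leRHS]big_seq; exact: ler_sum.
pose E i (p : 'rV[R]_d * 'rV[R]_d) := [:: (i, p.1 0 i); (i, p.2 0 i)].
pose L := flatten [seq E i p | i <- enum 'I_d, p <- s].
apply: (cut_ge0 (L := L) phiadd ax xy) => x' y' xx' x'y' y'y HL.
have ax' := vle_trans ax xx'.
have [lt|] := pselect (forall i, x' 0 i < y' 0 i); last first.
  move/existsNP => [i /negP]; rewrite -leNgt => yx.
  rewrite (@box_additive_degenerate a phi _ _ i)//.
  by apply/eqP; rewrite eq_le yx x'y'.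
have [p ps py] : exists2 p, p \in s & hob p.1 p.2 y'.
  by apply: cov => i; rewrite (le_lt_trans (xx' i) (lt i)) y'y.
rewrite subr_ge0.
have clp : cl x' y' p = c x' y'.
  congr (c _ _); apply/rowP => i; rewrite mxE; case/andP: (py i) => pi1 pi2.
    have : (i, p.1 0 i) \in L.
      apply/flattenP; exists [:: (i, p.1 0 i); (i, p.2 0 i)]; last by rewrite inE eqxx.
      by apply/allpairsP; exists (i, p) => /=; rewrite mem_enum.
    move=> /HL[/= px|/=]; last by rewrite leNgt pi1.
    by rewrite (max_idPr px) (min_idPl (x'y' i)).
  rewrite (max_idPl _) ?(min_idPr pi2)//; exact: le_trans (x'y' i) pi2.
rewrite -clp (perm_big _ (perm_to_rem ps)) big_cons/= lerDl.
rewrite big_seq; apply: sumr_ge0 => q /mem_rem qs; apply: c0.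
  exact: vle_trans (clamp_ge _ x'y').
by apply: le_clamp; case: (sP q qs).
Qed.

(** Raising the lower corner strictly puts the closed box from [x'] to [y] inside the half-open one,
    ready for compactness. One thin slab is removed per direction, each time spending half of the
    error that is left. *)
Lemma content_inner_approx a c x y (eps : R) : box_content a c ->
  vle a x -> (forall i, x 0 i < y 0 i) -> 0 < eps ->
  exists x', [/\ forall i, x 0 i < x' 0 i, vle x' y & c x y <= c x' y + eps].
Proof.
move=> cc ax xy e0.
suff H s : uniq s -> forall e : R, 0 < e -> exists x', [/\ vle x x',
    forall i, x 0 i < x' 0 i \/ (i \notin s /\ x' 0 i = x 0 i),
    forall i, x' 0 i < y 0 i & c x y <= c x' y + e].
  have [x' [xx' lt lty cxy]] := H _ (enum_uniq 'I_d) _ e0.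
  exists x'; split => // [i|i]; last exact: ltW.
  by have [//|[]] := lt i; rewrite mem_enum.
elim: s => [_ e e1|i s IH].
  exists x; split => // [i|]; first by right.
  by rewrite lerDl ltW.
rewrite cons_uniq => /andP[is_ us] e e1.
have e20 : 0 < e / 2 by rewrite divr_gt0.
have [x' [xx' lt lty cxy]] := IH us _ e20.
have ax' := vle_trans ax xx'.
have x'y : vle x' y by move=> j; exact: ltW.
have /cvgrPdist_lt /(_ _ e20) Hn := content_rcont cc i ax' x'y.
near (x' 0 i)^'+ => t.
have Ht : `|0 - c x' (set_coord y i t)| < e / 2 by near: t.
have x't : x' 0 i < t by near: t; exact: nbhs_right_gt.
have ty : t < y 0 i by near: t; exact: nbhs_right_lt.
have x't' := ltW x't; have ty' := ltW ty.
exists (set_coord x' i t); split.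
- by apply: (vle_trans xx'); apply: vle_set_coordr => //; exact: vle_refl.
- move=> j; rewrite set_coordE inE; case: eqP => [->|_] /=.
    by left; exact: le_lt_trans (xx' i) x't.
  exact: lt.
- by move=> j; rewrite set_coordE; case: eqP => [->|].
have xty : x' 0 i <= t <= y 0 i by rewrite x't'.
rewrite (le_trans cxy)// (content_add cc ax' x'y xty).
move: Ht; rewrite sub0r normrN => /(le_lt_trans (ler_norm _)) Ht.
by lra.
Unshelve. all: by end_near. Qed.

(** The open box from [x] to [y'] contains the half-open box from [x] to [y], which turns a cover by
    half-open boxes into an open cover at small cost. *)
Lemma content_outer_approx a c x y (eps : R) : box_content a c ->
  vle a x -> vle x y -> 0 < eps ->
  exists y', (forall i, y 0 i < y' 0 i) /\ c x y' <= c x y + eps.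
Proof.
move=> cc ax xy e0.
suff H s : uniq s -> forall e : R, 0 < e -> exists y', [/\ vle y y',
    forall i, y 0 i < y' 0 i \/ i \notin s & c x y' <= c x y + e].
  have [y' [yy' lt cxy]] := H _ (enum_uniq 'I_d) _ e0.
  by exists y'; split => // i; have [//|] := lt i; rewrite mem_enum.
elim: s => [_ e e1|i s IH].
  by exists y; split; [exact: vle_refl|move=> i; right|rewrite lerDl ltW].
rewrite cons_uniq => /andP[is_ us] e e1.
have e20 : 0 < e / 2 by rewrite divr_gt0.
have [y' [yy' lt cxy]] := IH us _ e20.
have xy' := vle_trans xy yy'.
have ax' : vle a (set_coord x i (y' 0 i)).
  by apply: vle_set_coordr => //; exact: le_trans (ax i) (xy' i).
have x'y : vle (set_coord x i (y' 0 i)) y' by apply: vle_set_coordl.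
have /cvgrPdist_lt := content_rcont cc i ax' x'y.
rewrite set_coord_same => /(_ _ e20) Hn.
near (y' 0 i)^'+ => t.
have Ht : `|0 - c (set_coord x i (y' 0 i)) (set_coord y' i t)| < e / 2 by near: t.
have y't : y' 0 i < t by near: t; exact: nbhs_right_gt.
have y't' := ltW y't.
exists (set_coord y' i t); split.
- by apply: (vle_trans yy'); apply: vle_set_coordr => //; exact: vle_refl.
- move=> j; rewrite set_coordE inE; case: eqP => [->|_] /=.
    by left; exact: le_lt_trans (yy' i) y't.
  exact: lt.
rewrite (content_add cc (y := set_coord y' i t) (i := i) (t := y' 0 i) ax).
- rewrite set_coord_twice set_coord_id.
  move: Ht; rewrite sub0r normrN => /(le_lt_trans (ler_norm _)) Ht.
  by lra.
- by apply: vle_set_coordr => //; exact: le_trans (xy' i) y't'.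
- by rewrite set_coord_same xy'.
Unshelve. all: by end_near. Qed.

End BoxFunctions.

(** * Variation of a box function *)

Section Variation.
Context {R : realType} {d : nat}.
Implicit Types (x y z a b N : 'rV[R]_d) (c phi : 'rV[R]_d -> 'rV[R]_d -> R).
Implicit Types (i j : 'I_d) (t s : R) (L : seq ('I_d * R)).

(** The sum of [|phi|] over the cells of the grid cut out by [L]. Moving [t] into the side of the
    box makes a hyperplane that misses the box cut off a degenerate cell, on which an additive [phi]
    vanishes. *)
Fixpoint cut_sum phi L x y : R :=
  if L is (i, t) :: L' then
    let t' := Num.min (Num.max t (x 0 i)) (y 0 i) in
    cut_sum phi L' x (set_coord y i t') + cut_sum phi L' (set_coord x i t') y
  else `|phi x y|.

Definition box_variation phi x y : R := sup [set cut_sum phi L x y | L in setT].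

Lemma cut_sum_ge0 phi L x y : 0 <= cut_sum phi L x y.
Proof. by elim: L x y => [|[i t] L IH] x y //=; rewrite addr_ge0. Qed.

(** The triangle inequality on each final cell. The induction has to exchange the new cut with those
    of [L], and only a cut in the same direction interferes with it. *)
Lemma cut_sum_split_le a phi L x y i t : box_additive a phi ->
  vle a x -> vle x y -> x 0 i <= t <= y 0 i ->
  cut_sum phi L x y <=
    cut_sum phi L x (set_coord y i t) + cut_sum phi L (set_coord x i t) y.
Proof.
move=> padd; elim: L x y t => [|[j s] L IH] x y t ax xy xty.
  by rewrite /= (padd _ _ _ _ ax xy xty) ler_normD.
have /andP[xt ty] := xty; rewrite /=.
set s' := Num.min (Num.max s (x 0 j)) (y 0 j).
have xs : x 0 j <= s' by rewrite le_min le_max lexx orbT xy.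
have sy : s' <= y 0 j by rewrite ge_min lexx orbT.
have axs : vle a (set_coord x j s') by apply: vle_set_coordr => //; exact: le_trans (ax j) xs.
have axt : vle a (set_coord x i t) by apply: vle_set_coordr => //; exact: le_trans (ax i) xt.
have xsy : vle (set_coord x j s') y by apply: vle_set_coordl.
have xys : vle x (set_coord y j s') by apply: vle_set_coordr.
have xty' : vle (set_coord x i t) y by apply: vle_set_coordl.
have [ji|ji] := eqVneq j i; last first.
  have ij : i != j by rewrite eq_sym.
  rewrite !(set_coord_neq _ _ ji) -/s'.
  have H1 := IH _ _ t ax xys; have H2 := IH _ _ t axs xsy.
  move: H1 H2; rewrite !(set_coord_neq _ _ ij) => /(_ xty) H1 /(_ xty) H2.
  rewrite [set_coord (set_coord y i t) j s']set_coordC//.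
  rewrite [set_coord (set_coord x i t) j s']set_coordC//.
  by apply: le_trans (lerD H1 H2) _; rewrite addrACA.
(* Two parallel cuts make three slabs. The fourth piece on the right is degenerate at [t], and its
   nonnegativity is enough. *)
subst j; rewrite !set_coord_same !set_coord_twice.
have E1 : Num.min (Num.max s (x 0 i)) t = Num.min s' t.
  by rewrite -minA (min_idPr ty).
have E2 : Num.min (Num.max s t) (y 0 i) = Num.max s' t.
  by rewrite max_minl -maxA (max_idPr xt) (max_idPl ty).
rewrite E1 E2; have [st|ts] := leP s' t.
  have xi : (set_coord x i s') 0 i <= t <= y 0 i by rewrite set_coord_same st.
  have := IH _ _ _ axs xsy xi; rewrite !set_coord_twice => H1.
  have := cut_sum_ge0 phi L (set_coord x i t) (set_coord y i t).
  by lra.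
have yi : x 0 i <= t <= set_coord y i s' 0 i by rewrite set_coord_same xt ltW.
have := IH _ _ _ ax xys yi; rewrite !set_coord_twice => H1.
have := cut_sum_ge0 phi L (set_coord x i t) (set_coord y i t).
by lra.
Qed.

Lemma cut_clampP i t x y : vle x y ->
  x 0 i <= Num.min (Num.max t (x 0 i)) (y 0 i) <= y 0 i.
Proof. by move=> xy; rewrite le_min le_max lexx orbT xy ge_min lexx orbT. Qed.

Lemma cut_vle a x y i t : vle a x -> vle x y -> x 0 i <= t <= y 0 i ->
  [/\ vle x (set_coord y i t), vle (set_coord x i t) y & vle a (set_coord x i t)].
Proof.
move=> ax xy /andP[xt ty]; split.
- by apply: vle_set_coordr.
- by apply: vle_set_coordl.
- by apply: vle_set_coordr => //; exact: le_trans (ax i) xt.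
Qed.

Lemma cut_sum_catl a phi L L' x y : box_additive a phi ->
  vle a x -> vle x y -> cut_sum phi L x y <= cut_sum phi (L' ++ L) x y.
Proof.
move=> padd; elim: L' x y => [//|[i t] L' IH] x y ax xy /=.
have H := cut_clampP i t xy; have [xy1 xy2 ax2] := cut_vle ax xy H.
by apply: le_trans (cut_sum_split_le _ padd ax xy H) _; rewrite lerD ?IH.
Qed.

Lemma cut_sum_catr a phi L L' x y : box_additive a phi ->
  vle a x -> vle x y -> cut_sum phi L x y <= cut_sum phi (L ++ L') x y.
Proof.
move=> padd; elim: L x y => [|[i t] L IH] x y ax xy.
  by have := cut_sum_catl [::] L' padd ax xy; rewrite cats0.
have H := cut_clampP i t xy; have [xy1 xy2 ax2] := cut_vle ax xy H.
by rewrite /= lerD ?IH.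
Qed.

Lemma cut_sum_le a phi c L x y : box_additive a c ->
  vle a x -> vle x y ->
  (forall x' y', vle x x' -> vle x' y' -> vle y' y -> `|phi x' y'| <= c x' y') ->
  cut_sum phi L x y <= c x y.
Proof.
move=> cadd; elim: L x y => [|[i t] L IH] x y ax xy H /=.
  by apply: H => //; exact: vle_refl.
have Hi := cut_clampP i t xy; have [xy1 xy2 ax2] := cut_vle ax xy Hi.
set s := Num.min _ _ in Hi xy1 xy2 ax2 *; have /andP[xs sy] := Hi.
rewrite (cadd _ _ _ _ ax xy Hi) lerD ?IH// => x' y' xx' x'y' y'y; apply: H => //.
  by apply: vle_trans y'y _; apply: vle_set_coordl => //; exact: vle_refl.
by apply: vle_trans xx'; apply: vle_set_coordr => //; exact: vle_refl.
Qed.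

(** The content may depend on [N], since a signed measure need only be finite on bounded boxes. *)
Definition content_dominated a phi := forall N, exists2 c, box_content a c &
  forall x y, vle a x -> vle x y -> vle y N -> `|phi x y| <= c x y.

Section Dominated.
Variables (a : 'rV[R]_d) (phi : 'rV[R]_d -> 'rV[R]_d -> R).
Hypotheses (padd : box_additive a phi) (pdom : content_dominated a phi).

Lemma cut_sum_le_variation L x y : vle a x -> vle x y ->
  cut_sum phi L x y <= box_variation phi x y.
Proof.
move=> ax xy; apply: ub_le_sup; last by exists L.
have [c cc cP] := pdom y; exists (c x y) => _ [K _ <-].
apply: (cut_sum_le _ (content_add cc)) => // x' y' xx' x'y' y'y.
by apply: cP => //; exact: vle_trans xx'.
Qed.

Lemma variation_le x y (M : R) : (forall L, cut_sum phi L x y <= M) ->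
  box_variation phi x y <= M.
Proof.
move=> H; apply: ge_sup; first by exists (cut_sum phi [::] x y), [::].
by move=> _ [L _ <-].
Qed.

Lemma variation_ge_norm x y : vle a x -> vle x y -> `|phi x y| <= box_variation phi x y.
Proof. exact: (cut_sum_le_variation [::]). Qed.

Lemma variation_additive : box_additive a (box_variation phi).
Proof.
move=> x y i t ax xy xty; have [xy1 xy2 ax2] := cut_vle ax xy xty.
apply/eqP; rewrite eq_le; apply/andP; split.
  apply: variation_le => L; apply: le_trans (cut_sum_split_le _ padd ax xy xty) _.
  by rewrite lerD ?cut_sum_le_variation.
rewrite -lerBrDr; apply: variation_le => L1; rewrite lerBrDr addrC -lerBrDr.
apply: variation_le => L2; rewrite lerBrDr.
(* After the cut at [t], the concatenated list refines [L1] on one half and [L2] on the other. *)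
apply: le_trans (cut_sum_le_variation ((i, t) :: (L1 ++ L2)) ax xy) => /=.
have -> : Num.min (Num.max t (x 0 i)) (y 0 i) = t.
  by case/andP: xty => xt ty; rewrite (max_idPl xt) (min_idPl ty).
by rewrite addrC lerD// ?(cut_sum_catl _ _ padd)// (cut_sum_catr _ _ padd).
Qed.

(** Right-continuity is squeezed out of a dominating content. Domination being local, the corner [N]
    leaves room for [t] beyond [y 0 i], as is needed when [x 0 i = y 0 i]. *)
Lemma variation_content : box_content a (box_variation phi).
Proof.
split; last 1 first.
- move=> x y i ax xy; pose N := set_coord y i (y 0 i + 1).
  have [c cc cP] := pdom N.
  have le1 : vle y N by apply: vle_set_coordr => //; rewrite lerDl.
  apply: (@squeeze_cvgr _ _ _ _ (fun=> 0) (fun t => c x (set_coord y i t)));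
    [|exact: cvg_cst|exact: (content_rcont cc)].
  near=> t.
  have xt : x 0 i <= t by apply: ltW; near: t; exact: nbhs_right_gt.
  have ty : t <= y 0 i + 1.
    by apply: ltW; near: t; apply: nbhs_right_lt; rewrite ltr_pwDr.
  have xyt : vle x (set_coord y i t) by apply: vle_set_coordr.
  rewrite (le_trans (normr_ge0 _) (variation_ge_norm ax xyt))/=.
  apply: variation_le => L; apply: (cut_sum_le _ (content_add cc)) => // x' y' xx' x'y' y'y.
  apply: cP => //; first exact: vle_trans xx'.
  by apply: vle_trans y'y _; apply: vle_set_coord.
- by move=> x y ax xy; exact: le_trans (normr_ge0 _) (variation_ge_norm ax xy).
- exact: variation_additive.
Unshelve. all: by end_near. Qed.

End Dominated.

End Variation.

(** * Product partitions and Hardy-Krause variation *)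

Section ProductPartitions.
Context {R : realType} {d : nat}.
Implicit Types (x y z a b u v : 'rV[R]_d) (c phi : 'rV[R]_d -> 'rV[R]_d -> R).
Implicit Types (i j : 'I_d) (s : seq 'I_d) (t : R) (P : 'I_d -> seq R).

Lemma line_partition_total a c u v i (p : seq R) : box_additive a c ->
  vle a u -> vle u v -> itv_partition (u 0 i) (v 0 i) p ->
  \sum_(m < size p) c (set_coord u i (nth 0 (u 0 i :: p) m))
                      (set_coord v i (nth 0 (u 0 i :: p) m.+1)) = c u v.
Proof.
move=> cadd; elim: p u => [|t p IH] u au uv.
  move=> /itv_partition_nil uvi; rewrite big_ord0.
  by rewrite (box_additive_degenerate cadd au uv uvi).
move=> up; have tv := itv_partition_le (itv_partition_cons up).
have ut : u 0 i <= t by case: up => /= /andP[/ltW].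
have utv : u 0 i <= t <= v 0 i by rewrite ut.
have [_ uv2 au2] := cut_vle au uv utv.
rewrite big_ord_recl/= set_coord_id.
rewrite (cadd u v i t)//; congr (_ + _).
rewrite -(IH _ au2 uv2) set_coord_same; last exact: itv_partition_cons up.
by apply: eq_bigr => m _; rewrite set_coord_twice.
Qed.

Lemma itv_partition_nth_mono (r t : R) (p : seq R) m n : itv_partition r t p ->
  (m <= n <= size p)%N -> nth 0 (r :: p) m <= nth 0 (r :: p) n.
Proof.
move=> [rp _] /andP[mn np].
have : sorted <=%R (r :: p)
  by apply: (@sub_sorted _ <%R <=%R) => // ? ?; exact: ltW.
by move/(sorted_leq_nth le_trans lexx); apply => //; rewrite inE /= ltnS// (leq_trans mn).
Qed.

Lemma itv_partition_bounds (r t : R) (p : seq R) m : itv_partition r t p ->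
  (m <= size p)%N -> r <= nth 0 (r :: p) m <= t.
Proof.
move=> rp mp; rewrite (itv_partition_nth_mono rp (_ : 0 <= m <= _)%N)//=.
have -> : t = nth 0 (r :: p) (size p).
  by case: rp => _ /eqP <-; rewrite -last_nth (last_nth 0).
by apply: (itv_partition_nth_mono rp); rewrite mp leqnn.
Qed.

Lemma itv_partition_refine (r t : R) (T : seq R) : r <= t ->
  exists2 p, itv_partition r t p & forall q, q \in T -> r < q < t -> q \in p.
Proof.
move=> rt; elim: T => [|q T [p pP pT]].
  (* Partitions are strictly increasing, so that of a degenerate interval has no further point. *)
  exists (if r < t then [:: t] else [::]) => //.
  case: ifPn => [|tr]; first exact: itv_partition1.
  by split => //=; rewrite eq_le rt leNgt.
have [/andP[rq qt]|rqt] := boolP (r < q < t); last first.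
  exists p => // q'; rewrite inE => /predU1P[->|]; last exact: pT.
  by rewrite (negbTE rqt).
exists (itv_partitionL p q ++ itv_partitionR p q).
  apply: itv_partition_cat; first exact: (itv_partitionLP rq qt pP).
  exact: (itv_partitionRP rq qt pP).
move=> q'; rewrite inE mem_cat mem_rcons inE => /predU1P[->|q'T rqt].
  by rewrite eqxx.
have := pT _ q'T rqt; rewrite !mem_filter => ->; rewrite !andbT.
by case: ltgtP.
Qed.

Section Cells.
Variables (x y : 'rV[R]_d) (P : 'I_d -> seq R).
Local Notation n := (\max_i size (P i)).
Local Notation K := {ffun 'I_d -> 'I_n.+1}.
Implicit Types (k : K).

Definition cell_lo k := \row_i nth 0 (x 0 i :: P i) (k i) : 'rV[R]_d.
Definition cell_hi k := \row_i nth 0 (x 0 i :: P i) (k i).+1 : 'rV[R]_d.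

Local Notation cell_idx D :=
  (pfamily ord0 D (fun i => [pred m : 'I_n.+1 | (m < size (P i))%N])).

Lemma cell_idxP (D : pred 'I_d) k : reflect
  ((forall i, i \notin D -> k i = ord0) /\ (forall i, i \in D -> (k i < size (P i))%N))
  (k \in cell_idx D).
Proof.
apply: (iffP pfamilyP) => -[H1 H2]; split => //.
  by move=> i iD; apply/eqP; apply: contraNT iD => /(fintype.subsetP H1).
by apply/fintype.subsetP => i; apply: contraR => iD; rewrite H1.
Qed.

Hypothesis PP : product_partition x y [set: 'I_d]%SET P.

Let PPi i : itv_partition (x 0 i) (y 0 i) (P i).
Proof. by apply: PP; rewrite inE. Qed.

Lemma cell_vle k : k \in cell_idx (mem [set: 'I_d]%SET) ->
  [/\ vle x (cell_lo k), vle (cell_lo k) (cell_hi k) & vle (cell_hi k) y].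
Proof.
move=> /cell_idxP[_ H]; have {}H i : (k i < size (P i))%N by apply: H; rewrite !inE.
split => i; rewrite !mxE.
- by have /andP[] := itv_partition_bounds (PPi i) (ltnW (H i)).
- by apply: (itv_partition_nth_mono (PPi i)); rewrite leqnSn H.
- by have /andP[] := itv_partition_bounds (PPi i) (H i).
Qed.

Lemma partition_total a c : box_additive a c -> vle a x -> vle x y ->
  \sum_(k in cell_idx (mem [set: 'I_d]%SET)) c (cell_lo k) (cell_hi k) = c x y.
Proof.
move=> cadd ax xy.
(* Only the directions in [s] are subdivided so far; in the others the cell keeps the whole side.
   The induction subdivides one more direction. *)
pose lo s k := \row_i (if i \in s then nth 0 (x 0 i :: P i) (k i) else x 0 i).
pose hi s k := \row_i (if i \in s then nth 0 (x 0 i :: P i) (k i).+1 else y 0 i).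
suff H s : uniq s -> \sum_(k in cell_idx (mem s)) c (lo s k) (hi s k) = c x y.
  rewrite -(H _ (enum_uniq 'I_d)); apply: eq_big => [k|k _].
    apply/cell_idxP/cell_idxP => -[H1 H2]; split=> i Hi;
      by [apply: H1; move: Hi; rewrite ?inE ?mem_enum|apply: H2; rewrite ?inE ?mem_enum].
  by congr (c _ _); apply/rowP => i; rewrite !mxE mem_enum.
elim: s => [_|i s IH].
  rewrite (big_pred1 [ffun=> ord0]).
    by congr (c _ _); apply/rowP => i; rewrite mxE.
  move=> k; apply/cell_idxP/eqP => [[H _]|->].
    by apply/ffunP => i; rewrite ffunE H.
  by split=> // i; rewrite ffunE.
rewrite cons_uniq => /andP[is_ us]; rewrite -{}IH//.
pose upd k (m : 'I_n.+1) : K := [ffun j => if j == i then m else k j].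
(* An index supported on [i :: s] is an index supported on [s] together with a position in direction
   [i]. *)
rewrite (reindex_onto (fun km : K * 'I_n.+1 => upd km.1 km.2) (fun k => (upd k ord0, k i)))/=; last first.
  move=> k _; apply/ffunP => j; rewrite !ffunE; by case: eqP => [->|].
rewrite (eq_bigl (fun km : K * 'I_n.+1 => (km.1 \in cell_idx (mem s)) && (km.2 < size (P i))%N)); last first.
  move=> [k m] /=; apply/andP/andP => [[/cell_idxP[H1 H2] /eqP[kE _]]|].
    have ki : k i = ord0 by rewrite -kE ffunE eqxx.
    split; last by have := H2 i; rewrite ffunE eqxx; apply; rewrite !inE eqxx.
    apply/cell_idxP; split => j js.
      have [->//|ji] := eqVneq j i.
      have := H1 j; rewrite ffunE (negbTE ji); apply.
      by rewrite !inE (negbTE ji).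
    have ji : j != i by apply: contraNneq is_ => <-.
    have := H2 j; rewrite ffunE (negbTE ji); apply.
    by rewrite !inE js orbT.
  move=> [/cell_idxP[H1 H2] mi]; have ki : k i = ord0 by apply: H1.
  split; last first.
    rewrite ffunE eqxx; apply/eqP; congr (_, _); apply/ffunP => j; rewrite !ffunE.
    by case: eqP => [->|].
  apply/cell_idxP; split => j; rewrite !inE ffunE.
    by rewrite negb_or; case: eqP => //= _; exact: H1.
  by case: eqP => [->|_] //=; exact: H2.
rewrite -(pair_big_dep (fun k : K => k \in cell_idx (mem s)) (fun (_ : K) (m : 'I_n.+1) => m < size (P i))%N
   (fun k m => c (lo (i :: s) (upd k m)) (hi (i :: s) (upd k m))))/=.
apply: eq_bigr => k /cell_idxP[H1 H2].
have loi : lo s k 0 i = x 0 i by rewrite mxE (negbTE is_).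
have hii : hi s k 0 i = y 0 i by rewrite mxE (negbTE is_).
have xlo : vle x (lo s k).
  move=> j; rewrite mxE; case: ifP => // js.
  by have /andP[] := itv_partition_bounds (PPi j) (ltnW (H2 j js)).
have lohi : vle (lo s k) (hi s k).
  move=> j; rewrite !mxE; case: ifP => js; last exact: xy.
  by apply: (itv_partition_nth_mono (PPi j)); rewrite leqnSn H2.
have := @line_partition_total a c (lo s k) (hi s k) i (P i) cadd.
rewrite loi hii => <- //; last exact: vle_trans xlo.
have szi : (size (P i) <= n.+1)%N by rewrite leqW// (leq_bigmax i).
rewrite (big_ord_widen n.+1 (fun m => c (set_coord (lo s k) i (nth 0 (x 0 i :: P i) m))
   (set_coord (hi s k) i (nth 0 (x 0 i :: P i) m.+1))) szi).
apply: eq_bigr => m mi; congr (c _ _); apply/rowP => j; rewrite !mxE inE ffunE.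
  by case: eqP => [->|].
by case: eqP => [->|].
Qed.

End Cells.

End ProductPartitions.

(** * Hardy-Krause variation of functions vanishing on the faces *)

Section HardyKrause.
Context {R : realType} {d : nat}.
Implicit Types (x y z a b u v : 'rV[R]_d) (c phi : 'rV[R]_d -> 'rV[R]_d -> R).
Implicit Types (f g G : 'rV[R]_d -> R).
Implicit Types (i j : 'I_d) (s : seq 'I_d) (t : R) (P : 'I_d -> seq R).

Local Notation cell_idx P := (pfamily ord0 (mem [set: 'I_d]%SET)
  (fun i => [pred m : 'I_(\max_i size (P i)).+1 | (m < size (P i))%N])).

Lemma clamp_id x y u : vle x u -> vle u y -> clamp x y u = u.
Proof.
move=> xu uy; apply/rowP => i.
by rewrite mxE (max_idPl (xu i)) (min_idPl (uy i)).
Qed.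

(** Complements [clamp_additive]: here the window from [u] to [v] is fixed and the clipped box is
    cut, which cuts its trace at the clamped value of [t]. *)
Lemma clamp_corner_additive a b c u v : box_additive a c -> vle a u -> vle u v ->
  box_additive b (fun p q => c (clamp u v p) (clamp u v q)).
Proof.
move=> cadd au uv p q i t bp pq /andP[pt tq].
pose t' := Num.min (Num.max t (u 0 i)) (v 0 i).
have E r : clamp u v (set_coord r i t) = set_coord (clamp u v r) i t'.
  by apply/rowP => j; rewrite !mxE; case: eqP => [->|].
rewrite !E; apply: cadd.
- exact: vle_trans (clamp_ge _ uv).
- exact: le_clamp.
- by rewrite !mxE /t' !(le_min2, le_max2).
Qed.

Section VariationAsPartitionSup.
Variables (a : 'rV[R]_d) (phi : 'rV[R]_d -> 'rV[R]_d -> R).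
Hypotheses (padd : box_additive a phi) (pdom : content_dominated a phi).
Variables (x y : 'rV[R]_d).
Hypotheses (ax : vle a x) (xy : vle x y).

Lemma partition_le_variation P : product_partition x y [set: 'I_d]%SET P ->
  \sum_(k in cell_idx P) `|phi (cell_lo x k) (cell_hi x k)| <=
  box_variation phi x y.
Proof.
move=> PP; rewrite -(partition_total PP (variation_additive padd pdom) ax xy).
apply: ler_sum => k kP; have [xlo lohi hiy] := cell_vle PP kP.
by apply: (variation_ge_norm pdom) => //; exact: vle_trans xlo.
Qed.

(** Since every threshold of [L] is a point of [P], each cell lies on one side of the hyperplane. Of
    the two pieces of a clipped cell one is then degenerate, and the absolute value splits without
    loss. Without cuts this is the triangle inequality. *)
Lemma cut_sum_le_clamped P L u v : product_partition x y [set: 'I_d]%SET P ->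
  (forall i t, (i, t) \in L -> x 0 i < t < y 0 i -> t \in P i) ->
  vle x u -> vle u v -> vle v y ->
  cut_sum phi L u v <=
  \sum_(k in cell_idx P) `|phi (clamp u v (cell_lo x k)) (clamp u v (cell_hi x k))|.
Proof.
move=> PP; elim: L u v => [|[i t] L IH] u v LP xu uv vy.
  have au := vle_trans ax xu.
  have := partition_total PP (clamp_corner_additive (b := a) padd au uv) ax xy.
  have uy := vle_trans uv vy; have xv := vle_trans xu uv.
  have -> : clamp u v x = u.
    by apply/rowP => i; rewrite mxE (max_idPr (xu i)) (min_idPl (uv i)).
  have -> : clamp u v y = v.
    by apply/rowP => i; rewrite mxE (max_idPl (uy i)) (min_idPr (vy i)).
  by rewrite /= => <-; exact: ler_norm_sum.
have au := vle_trans ax xu.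
have Hi := cut_clampP i t uv; have [uv1 uv2 au2] := cut_vle au uv Hi.
rewrite /=; set t' := Num.min _ _ in Hi uv1 uv2 au2 *; have /andP[ut tv] := Hi.
have LP' j r : (j, r) \in L -> x 0 j < r < y 0 j -> r \in P j.
  by move=> jr; apply: LP; rewrite inE jr orbT.
have vy1 : vle (set_coord v i t') y.
  by apply: vle_trans vy; apply: vle_set_coordl => //; exact: vle_refl.
have xu2 : vle x (set_coord u i t').
  by apply: vle_set_coordr => //; exact: le_trans (xu i) ut.
apply: le_trans (lerD (IH _ _ LP' xu uv1 vy1) (IH _ _ LP' xu2 uv2 vy)) _.
rewrite -big_split/=; apply: ler_sum => k kP.
have [xlo lohi hiy] := cell_vle PP kP.
rewrite (clamp_additive padd lohi au uv Hi).
set p1 := phi (clamp u _ _) _; set p2 := phi (clamp _ v _) _.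
suff [->|->] : p1 = 0 \/ p2 = 0 by rewrite normr0 ?add0r ?addr0.
have deg1 : clamp u (set_coord v i t') (cell_lo x k) 0 i =
    clamp u (set_coord v i t') (cell_hi x k) 0 i -> p1 = 0.
  apply: (box_additive_degenerate padd); last exact: le_clamp.
  exact: vle_trans (clamp_ge _ uv1).
have deg2 : clamp (set_coord u i t') v (cell_lo x k) 0 i =
    clamp (set_coord u i t') v (cell_hi x k) 0 i -> p2 = 0.
  apply: (box_additive_degenerate padd); last exact: le_clamp.
  exact: vle_trans (clamp_ge _ uv2).
have [tE|ut'] := eqVneq t' (u 0 i).
  left; apply: deg1; rewrite tE !mxE eqxx.
  by rewrite !(min_idPr _)// le_max lexx orbT.
have [tE|tv'] := eqVneq t' (v 0 i).
  right; apply: deg2; rewrite tE !mxE eqxx.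
  by rewrite !(min_idPr _)// le_max lexx orbT.
have t'E : t' = t.
  move: ut' tv'; rewrite /t'; case: (leP t (u 0 i)) => tu.
    by rewrite (min_idPl (uv i)) eqxx.
  by case: (leP t (v 0 i)) => // _; rewrite eqxx.
have tP : t \in P i.
  apply: LP; first exact: mem_head.
  rewrite (le_lt_trans (xu i)); last by rewrite -t'E lt_def ut' ut.
  by rewrite (lt_le_trans _ (vy i))// -t'E lt_def eq_sym tv' tv.
have PPi : itv_partition (x 0 i) (y 0 i) (P i) by apply: PP; rewrite inE.
have ki : (k i < size (P i))%N by have /pfamilyP[_ /(_ i)] := kP; apply; rewrite !inE.
(* The successor accounts for the first point [x 0 i], which [P i] omits. The cell lies below the
   hyperplane exactly when [k i < m]. *)
pose m := (index t (P i)).+1.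
have tm : t = nth 0 (x 0 i :: P i) m by rewrite /= nth_index.
have mP : (m <= size (P i))%N by rewrite index_mem.
have [km|mk] := ltnP (k i) m.
  right; apply: deg2; rewrite !mxE eqxx t'E; congr Num.min.
  have hit : nth 0 (x 0 i :: P i) (k i).+1 <= t.
    by rewrite tm; apply: (itv_partition_nth_mono PPi); rewrite km.
  have lot : nth 0 (x 0 i :: P i) (k i) <= t.
    by have := lohi i; rewrite !mxE => /le_trans; apply.
  by rewrite (max_idPr lot) (max_idPr hit).
left; apply: deg1; rewrite !mxE eqxx t'E.
have lot : t <= nth 0 (x 0 i :: P i) (k i).
  by rewrite tm; apply: (itv_partition_nth_mono PPi); rewrite mk ltnW.
have hit : t <= nth 0 (x 0 i :: P i) (k i).+1.
  by have := lohi i; rewrite !mxE; exact: le_trans.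
by rewrite !(min_idPr _)// le_max ?lot ?hit.
Qed.

Lemma cut_sum_le_partition L : exists2 P, product_partition x y [set: 'I_d]%SET P &
  cut_sum phi L x y <= \sum_(k in cell_idx P) `|phi (cell_lo x k) (cell_hi x k)|.
Proof.
have /choice[P HP] : forall i, exists p, itv_partition (x 0 i) (y 0 i) p /\
    forall q, q \in [seq r.2 | r <- L & r.1 == i] -> x 0 i < q < y 0 i -> q \in p.
  by move=> i; have [p pP pT] := itv_partition_refine [seq r.2 | r <- L & r.1 == i] (xy i); exists p.
have PP : product_partition x y [set: 'I_d]%SET P by move=> i _; case: (HP i).
exists P => //.
apply: le_trans (cut_sum_le_clamped PP _ (vle_refl x) xy (vle_refl y)) _.
  move=> i t iL; case: (HP i) => _; apply.
  by apply/mapP; exists (i, t) => //; rewrite mem_filter eqxx.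
apply: ler_sum => k kP; have [xlo lohi hiy] := cell_vle PP kP.
have xhi := vle_trans xlo lohi; have loy := vle_trans lohi hiy.
by rewrite !clamp_id.
Qed.

End VariationAsPartitionSup.

(** A proper marginal is a value on a face, hence 0. The full index set is a summand because [0 < d]
    makes it nonempty. *)
Lemma VarHK_vanishing G x : (0 < d)%N -> component_right_continuous G ->
  (forall z i, orthant z -> z 0 i = 0 -> G z = 0) -> orthant x ->
  VarHK 0 x G = ereal_sup
    [set (\sum_(k in cell_idx P) `|Delta (cell_lo 0 k) (cell_hi 0 k) G|)%:E
    | P in [set P | product_partition 0 x [set: 'I_d]%SET P]].
Proof.
move=> d0 rG G0 x0; rewrite /VarHK (bigD1 [set: 'I_d]%SET)/=; last first.
  by apply/negP => /eqP/(congr1 (fun A : {set 'I_d} => #|A|)); rewrite cardsT card_ord cards0 => dE; rewrite dE in d0.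
rewrite [X in (_ + X)%E]big1 ?adde0.
  congr ereal_sup; apply/seteqP; split => _ [P PP <-]; exists P => //; congr EFin;
    apply: eq_bigr => k kP; congr (`|_|); have [xlo lohi hiy] := cell_vle PP kP.
    apply: (eq_Delta_on (a := 0)) => // z z0; rewrite lower_marginalE//.
    by congr G; apply/rowP => i; rewrite mxE inE.
  apply/esym; apply: (eq_Delta_on (a := 0)) => // z z0; rewrite lower_marginalE//.
  by congr G; apply/rowP => i; rewrite mxE inE.
move=> I /andP[I0 IT].
rewrite (_ : [set _ | _ in _] = [set 0%E]) ?ereal_sup1//.
have [j jI] : exists j, j \notin I.
  apply/existsP; rewrite -negb_forall; apply: contra IT => /forallP IT.
  by apply/eqP/finset.setP => i; rewrite inE IT.
have S0 P : product_partition 0 x I P -> partition_sum 0 I P G = 0.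
  move=> PP; apply: big1 => k /pfamilyP[/supportP kI kP].
  apply/eqP; rewrite normr_eq0; apply/eqP.
  (* The marginal is zero on the orthant; writing zero as a difference lets [iter_diffB] finish. *)
  rewrite /Delta_on (@eq_iter_diff _ _ 0 _ _ _ (fun z => G z - G z)).
  - by rewrite iter_diffB subrr.
  - move=> z z0; rewrite lower_marginalE// subrr; apply: (G0 _ j).
      by apply: orthantP => i; rewrite mxE; case: ifP => // _; exact: orthant_ge0.
    by rewrite mxE (negbTE jI).
  - move=> i; rewrite mem_enum => iI; rewrite !mxE subr_ge0.
    have kPi : (k i < size (P i))%N := kP i iI.
    by have := PP i iI; rewrite !mxE => /itv_partition_nth_mono; apply; rewrite leqnSn.
  - move=> i; rewrite !mxE; have [iI|/kI ->//] := boolP (i \in I).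
    have kPi : (k i < size (P i))%N := kP i iI.
    have := PP i iI; rewrite !mxE => /itv_partition_bounds => /(_ (k i) (ltnW kPi)).
    by case/andP.
apply/seteqP; split => [_ [P PP <-]|_ ->]; first by rewrite S0.
(* Without a partition the supremum would be [-oo] instead of 0. *)
have [P PP] : exists P, product_partition 0 x I P.
  have /choice[P HP] : forall i, exists p, itv_partition ((0 : 'rV[R]_d) 0 i) (x 0 i) p.
    by move=> i; have [p pP _] := itv_partition_refine [::] (x0 i); exists p.
  by exists P => i _.
by exists P => //; rewrite S0.
Qed.

Lemma Delta_vanishing G x : (forall z i, orthant z -> z 0 i = 0 -> G z = 0) ->
  orthant x -> Delta 0 x G = G x.
Proof.
move=> G0 x0; rewrite Delta_sum (bigD1 [set: 'I_d]%SET)//= big1 ?addr0.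
  rewrite cardsT card_ord subnn mul1r; congr G; apply/rowP => i.
  by rewrite mxE inE.
move=> I IT; have [j jI] : exists j, j \notin I.
  apply/existsP; rewrite -negb_forall; apply: contra IT => /forallP IT.
  by apply/eqP/finset.setP => i; rewrite inE IT.
rewrite (G0 _ j) ?mulr0//; last by rewrite !mxE (negbTE jI).
by apply: orthantP => i; rewrite !mxE; case: ifP => // _; exact: orthant_ge0.
Qed.

(** The absolute values are redundant, so every partition sum has the same total. *)
Lemma VarHK_increasing g x : (0 < d)%N -> component_right_continuous g ->
  (forall z i, orthant z -> z 0 i = 0 -> g z = 0) ->
  (forall u v, orthant u -> vle u v -> 0 <= Delta u v g) -> orthant x ->
  VarHK 0 x g = (g x)%:E.
Proof.
move=> d0 rg g0 dg x0; rewrite VarHK_vanishing//.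
rewrite (_ : [set _ | _ in _] = [set (g x)%:E]) ?ereal_sup1//.
have S P : product_partition 0 x [set: 'I_d]%SET P ->
    \sum_(k in cell_idx P) `|Delta (cell_lo 0 k) (cell_hi 0 k) g| = g x.
  move=> PP; rewrite -(Delta_vanishing g0 x0).
  rewrite -(partition_total PP (@Delta_additive _ _ 0 g) (vle_refl _) x0).
  apply: eq_bigr => k kP; have [xlo lohi hiy] := cell_vle PP kP.
  by rewrite ger0_norm// dg.
apply/seteqP; split => [_ [P PP <-]|_ ->]; first by rewrite S.
have /choice[P HP] : forall i, exists p, itv_partition ((0 : 'rV[R]_d) 0 i) (x 0 i) p.
  by move=> i; have [p pP _] := itv_partition_refine [::] (x0 i); exists p.
have PP : product_partition 0 x [set: 'I_d]%SET P by move=> i _.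
by exists P => //; rewrite S.
Qed.

Lemma VarHK_variation phi G x : (0 < d)%N -> component_right_continuous G ->
  (forall z i, orthant z -> z 0 i = 0 -> G z = 0) ->
  box_additive 0 phi -> content_dominated 0 phi ->
  (forall u v, orthant u -> vle u v -> Delta u v G = phi u v) -> orthant x ->
  VarHK 0 x G = (box_variation phi 0 x)%:E.
Proof.
move=> d0 rG G0 padd pdom DG x0; rewrite VarHK_vanishing//.
set S := [set _ | _ in _].
have SE P : product_partition 0 x [set: 'I_d]%SET P ->
    \sum_(k in cell_idx P) `|Delta (cell_lo 0 k) (cell_hi 0 k) G| =
    \sum_(k in cell_idx P) `|phi (cell_lo 0 k) (cell_hi 0 k)|.
  move=> PP; apply: eq_bigr => k kP; have [xlo lohi hiy] := cell_vle PP kP.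
  by rewrite DG.
apply/eqP; rewrite eq_le; apply/andP; split.
  apply: ge_ereal_sup => _ [P PP <-]; rewrite lee_fin SE//.
  exact: (partition_le_variation padd pdom (vle_refl _) x0).
have H L : ((cut_sum phi L 0 x)%:E <= ereal_sup S)%E.
  have [P PP LP] := cut_sum_le_partition padd (vle_refl _) x0 L.
  apply: (@le_trans _ _ (\sum_(k in cell_idx P) `|phi (cell_lo 0 k) (cell_hi 0 k)|)%:E).
    by rewrite lee_fin.
  by apply: ereal_sup_ubound; exists P => //; rewrite SE.
move: (ereal_sup S) H => [r| |] H.
- by rewrite lee_fin; apply: variation_le => L; rewrite -lee_fin.
- by rewrite leey.
- by have := H [::].
Qed.

End HardyKrause.

(** * Borel sets and signed measures *)

Section MeasureRightLimit.
Context {dsp : measure_display} {T : measurableType dsp} {R : realType}.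

(** Continuity from above along the sequence a + (b - a)/(n + 1); monotonicity controls the values
    of [t] between its terms. *)
Lemma cvg_measure_at_right (mu : {measure set T -> \bar R}) (E : R -> set T) (a b : R) :
  a < b -> (forall t, a < t -> measurable (E t)) ->
  (forall s t, a < s -> s <= t -> E s `<=` E t) -> (mu (E b) < +oo)%E ->
  fine (mu (E t)) @[t --> a^'+] --> fine (mu (\bigcap_(t in [set t | a < t]) E t)).
Proof.
move=> ab mE ndE Eb.
have ba : 0 < b - a by rewrite subr_gt0.
pose r n : R := a + (b - a) * n.+1%:R^-1.
have ra n : a < r n by rewrite ltrDl mulr_gt0.
have rb n : r n <= b.
  by rewrite -lerBrDl ler_piMr ?(ltW ba)// invf_le1 ?ltr0n// ler1n.
pose F n := E (r n).
have FE : \bigcap_n F n = \bigcap_(t in [set t | a < t]) E t.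
  apply/seteqP; split => z Fz; last by move=> n _; exact: (Fz _ (ra n)).
  move=> t /= at_.
  have ta : 0 < (t - a) / (b - a) by rewrite divr_gt0 ?subr_gt0.
  have [n Hn] : exists n, n.+1%:R^-1 < (t - a) / (b - a).
    have [N _ HN] := near_infty_natSinv_lt (PosNum ta); exists N; exact: (HN N (leqnn N)).
  apply: (ndE (r n)) => //; last exact: (Fz n).
  by rewrite /r -lerBrDl mulrC -ler_pdivlMr// ltW.
have mF n : measurable (F n) by exact: mE.
have Ffin n : (mu (F n) < +oo)%E.
  by apply: le_lt_trans Eb; apply: le_measure; rewrite ?inE; [exact: mE|exact: mE|exact: ndE].
have cF : (mu \o F) n @[n --> \oo] --> mu (\bigcap_n F n).
  apply: nonincreasing_cvg_mu => //; first exact: bigcapT_measurable.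
  apply/nonincreasing_seqP => n; apply/subsetPset; apply: ndE => //.
  rewrite lerD2l ler_wpM2l ?(ltW ba)// lef_pV2 ?posrE// ler_nat.
  by rewrite ltnS.
have mI : measurable (\bigcap_n F n) by exact: bigcapT_measurable.
have Ifin : (mu (\bigcap_n F n) \is a fin_num).
  rewrite ge0_fin_numE// (le_lt_trans _ (Ffin 0%N))//.
  by apply: le_measure; rewrite ?inE//; exact: bigcap_inf.
rewrite -FE; rewrite -(fineK Ifin) in cF; move/fine_cvg/cvgrPdist_lt : cF => cF.
apply/cvgrPdist_lt => e e0; have [n _ /(_ n (leqnn n)) /=] := cF _ e0.
set l := fine (mu (\bigcap_n F n)) => ln.
near=> t.
have at_ : a < t by near: t; exact: nbhs_right_gt.
have tn : t <= r n by apply: ltW; near: t; exact: nbhs_right_lt.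
have mt : measurable (E t) by exact: mE.
have tfin : (mu (E t) \is a fin_num).
  rewrite ge0_fin_numE// (le_lt_trans _ (Ffin n))//.
  by apply: le_measure; rewrite ?inE//; exact: ndE.
have lt : l <= fine (mu (E t)).
  rewrite fine_le// le_measure ?inE// FE; exact: bigcap_inf.
have tln : fine (mu (E t)) <= fine (mu (F n)).
  have Fnfin : mu (F n) \is a fin_num by rewrite ge0_fin_numE.
  by rewrite fine_le// le_measure ?inE//; exact: ndE.
rewrite distrC ger0_norm ?subr_ge0//; move: ln; rewrite distrC.
by move=> /(le_lt_trans (ler_norm _)); apply: le_lt_trans; rewrite lerD2r.
Unshelve. all: by end_near. Qed.

End MeasureRightLimit.

Section BorelSets.
Context {R : realType} {d : nat}.
Implicit Types (x y z a u v N : 'rV[R]_d) (i j : 'I_d) (t : R).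

(** The sigma-algebra lives on the whole space so that library measures and charges apply. The sets
    of [borel_orthant] are its members contained in the orthant. *)
Definition borel_rV := g_sigma_algebraType (open : set_system 'rV[R]_d).

Lemma open_coord_lt i t : open [set z : 'rV[R]_d | z 0 i < t].
Proof.
apply: (@open_comp _ _ (fun z : 'rV[R]_d => z 0 i) [set r | r < t]) => [z _|].
  exact: coord_continuous.
exact: open_lt.
Qed.

Lemma open_coord_gt i t : open [set z : 'rV[R]_d | t < z 0 i].
Proof.
apply: (@open_comp _ _ (fun z : 'rV[R]_d => z 0 i) [set r | t < r]) => [z _|].
  exact: coord_continuous.
exact: open_gt.
Qed.

Lemma borel_coord_gt i t : measurable ([set z | t < z 0 i] : set borel_rV).
Proof. by apply: sub_sigma_algebra; exact: open_coord_gt. Qed.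

Lemma borel_coord_le i t : measurable ([set z | z 0 i <= t] : set borel_rV).
Proof.
rewrite (_ : [set z | _] = ~` [set z | t < z 0 i]).
  by apply: measurableC; exact: borel_coord_gt.
by apply/seteqP; split => z /=; [move=> ?; apply/negP|move/negP]; rewrite -leNgt.
Qed.

Lemma borel_coord_ge i t : measurable ([set z | t <= z 0 i] : set borel_rV).
Proof.
rewrite (_ : [set z | _] = ~` [set z | z 0 i < t]).
  by apply: measurableC; apply: sub_sigma_algebra; exact: open_coord_lt.
by apply/seteqP; split => z /=; [move=> ?; apply/negP|move/negP]; rewrite -leNgt.
Qed.

Lemma borel_forall (I : finType) (A : I -> set 'rV[R]_d) :
  (forall k, measurable (A k : set borel_rV)) ->
  measurable ([set z | forall k, A k z] : set borel_rV).
Proof.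
move=> mA; rewrite (_ : [set z | _] = \bigcap_(k in [set: I]) A k).
  by apply: fin_bigcap_measurable => //; exact: finite_finset.
by apply/seteqP; split => z /= Az k; [move=> _|]; exact: Az.
Qed.

Lemma borel_hob x y : measurable (hob x y : set borel_rV).
Proof.
apply: (borel_forall (A := fun i => [set z | x 0 i < z 0 i <= y 0 i])) => i.
rewrite (_ : [set z | _] = [set z | x 0 i < z 0 i] `&` [set z | z 0 i <= y 0 i]).
  by apply: measurableI; [exact: borel_coord_gt|exact: borel_coord_le].
by apply/seteqP; split => z /= /andP.
Qed.

Lemma borel_box x y : measurable (box x y : set borel_rV).
Proof.
rewrite (_ : box x y = [set z | forall i, x 0 i <= z 0 i] `&`
                       [set z | forall i, z 0 i <= y 0 i]) //.
apply: measurableI; apply: borel_forall => i.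
  exact: borel_coord_ge.
exact: borel_coord_le.
Qed.

Lemma borel_orthant_setI (A : set borel_rV) : measurable A ->
  borel_orthant (orthant `&` A).
Proof.
move: A; apply: smallest_sub => [|U oU]; last by apply: sub_sigma_algebra; exists U.
split.
- by rewrite /= setI0; exact: sigma_algebra0.
- move=> A oA /=; rewrite setTD (_ : _ `&` _ = orthant `\` (orthant `&` A)).
    exact: sigma_algebraCD.
  by rewrite setDE setCI setIUr setICr set0U.
- by move=> F oF /=; rewrite setI_bigcupr; exact: sigma_algebra_bigcup.
Qed.

Lemma borel_orthant_sub (A : set borel_rV) : measurable A -> A `<=` orthant ->
  borel_orthant A.
Proof. by move=> mA AO; rewrite -(setIidr AO); exact: borel_orthant_setI. Qed.

Lemma hob_orthant x y : orthant x -> hob x y `<=` orthant.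
Proof. by move=> x0 z xz i; apply: le_trans (x0 i) _; case/andP: (xz i) => /ltW. Qed.

Lemma hob_split x y i t : vle x y -> x 0 i <= t <= y 0 i ->
  hob x y = hob x (set_coord y i t) `|` hob (set_coord x i t) y.
Proof.
move=> xy /andP[xt ty]; apply/seteqP; split => [z xzy|z [] xz j].
- have [zt|tz] := leP (z 0 i) t; [left|right] => j; rewrite set_coordE;
    case: eqP => [->|_]; rewrite ?xzy//.
    by case/andP: (xzy i) => ->.
  by case/andP: (xzy i) => _ ->; rewrite tz.
- have := xz j; rewrite set_coordE; case: eqP => [-> /andP[-> /=]|//].
  by move=> /le_trans; apply.
- have := xz j; rewrite set_coordE; case: eqP => [-> /andP[tz ->]|//].
  by rewrite (le_lt_trans xt tz).
Qed.

Lemma hob_split_disjoint x y i t :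
  hob x (set_coord y i t) `&` hob (set_coord x i t) y = set0.
Proof.
apply/seteqP; split => // z [] /(_ i) /andP[_]; rewrite set_coord_same => zt.
by move=> /(_ i); rewrite set_coord_same ltNge zt.
Qed.

Lemma measure_box_content a (m : {measure set borel_rV -> \bar R}) :
  (m setT < +oo)%E -> box_content a (fun x y => fine (m (hob x y))).
Proof.
move=> mfin.
have mhob x y : m (hob x y) \is a fin_num.
  rewrite ge0_fin_numE//; apply: le_lt_trans mfin.
  by apply: le_measure => //; rewrite inE//; exact: borel_hob.
split => [x y _ _|x y i t _ xy xty|x y i ax xy].
- exact: fine_ge0.
- rewrite (hob_split xy xty) measureU; [|exact: borel_hob|exact: borel_hob|exact: hob_split_disjoint].
  by rewrite fineD ?mhob.
have := @cvg_measure_at_right _ _ _ m (fun t => hob x (set_coord y i t)) (x 0 i) (x 0 i + 1).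
(* The lower side is excluded from the slabs: a common point would lie below the midpoint between
   [x 0 i] and its own coordinate. *)
rewrite (_ : \bigcap_(_ in _) _ = set0).
  rewrite measure0; apply.
  - by rewrite ltrDl.
  - by move=> t _; exact: borel_hob.
  - move=> s t _ st z xz j; have := xz j; rewrite !set_coordE; case: eqP => [->|//].
    by move=> /andP[-> /le_trans]; apply.
  - by rewrite -ge0_fin_numE.
apply/seteqP; split => // z Hz.
have x1 : x 0 i < x 0 i + 1 by rewrite ltrDl.
have xz : x 0 i < z 0 i by case/andP: (Hz _ x1 i).
have xm : x 0 i < (x 0 i + z 0 i) / 2 by rewrite midf_lt.
case/andP: (Hz _ xm i) => _.
by rewrite set_coord_same leNgt midf_lt.
Qed.

End BorelSets.

(** * Signed measures restricted to sets of finite measure *)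

Section SignedMeasures.
Context {R : realType} {d : nat}.
Local Open Scope ereal_scope.
Implicit Types (nu : set 'rV[R]_d -> \bar R) (A B K : set (borel_rV (R := R) (d := d))).

Lemma signed_measureU nu A B : signed_measure borel_orthant nu ->
  measurable A -> measurable B -> A `<=` orthant -> B `<=` orthant ->
  A `&` B = set0 -> nu (A `|` B) = nu A + nu B.
Proof.
move=> [nu0 _ nus] mA mB AO BO AB0.
have := nus (bigcup2 A B); rewrite bigcup2E => H.
have {}H : (\sum_(0 <= k < n) nu (bigcup2 A B k)) @[n --> \oo] --> nu (A `|` B).
  apply: H.
    move=> [|[|n]] /=; [exact: borel_orthant_sub|exact: borel_orthant_sub|exact: sigma_algebra0].
  by rewrite -trivIset_bigcup2.
suff H' : (\sum_(0 <= k < n) nu (bigcup2 A B k)) @[n --> \oo] --> nu A + nu B.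
  exact: (cvg_unique _ H H').
apply: cvg_near_cst; exists 2%N => // -[|[|n]] //= _.
by rewrite big_nat_recl// big_nat_recl//= big1 ?adde0.
Qed.

(** The values on [A] and on its complement in [K] cannot be opposite infinities, so their finite
    sum forces both to be finite. *)
Lemma signed_measure_fin_sub nu A K : signed_measure borel_orthant nu ->
  measurable A -> measurable K -> K `<=` orthant -> A `<=` K ->
  nu K \is a fin_num -> nu A \is a fin_num.
Proof.
move=> nus mA mK KO AK.
have AO := subset_trans AK KO.
have mKA : measurable (K `\` A) by exact: measurableD.
have KAO : K `\` A `<=` orthant by apply: subset_trans KO; exact: subDsetl.
have := signed_measureU nus mA mKA AO KAO (setDIK _ _).
rewrite setDUK// => ->; case: (nus) => _ [noy|noN] _.
- have := noy _ (borel_orthant_sub mA AO).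
  have := noy _ (borel_orthant_sub mKA KAO).
  by case: (nu A) (nu (K `\` A)) => [r||] [s||].
- have := noN _ (borel_orthant_sub mA AO).
  have := noN _ (borel_orthant_sub mKA KAO).
  by case: (nu A) (nu (K `\` A)) => [r||] [s||].
Qed.

Section Restriction.
Variables (nu : set 'rV[R]_d -> \bar R) (K : set (borel_rV (R := R) (d := d))).
Hypotheses (nus : signed_measure borel_orthant nu) (mK : measurable K).
Hypotheses (KO : K `<=` orthant) (Kfin : nu K \is a fin_num).

(** Unlike [nu], this is finite on all measurable sets, hence a charge with a Hahn decomposition. *)
Let restriction A : \bar R := nu (K `&` A).

Let restriction0 : restriction set0 = 0.
Proof. by rewrite /restriction setI0; case: nus. Qed.

Let restriction_fin A : measurable A -> restriction A \is a fin_num.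
Proof.
move=> mA; apply: (signed_measure_fin_sub nus _ mK KO _ Kfin); last exact: subIsetl.
exact: measurableI.
Qed.

Let restriction_sigma : semi_sigma_additive restriction.
Proof.
move=> F mF tF _; rewrite /restriction setI_bigcupr; case: (nus) => _ _; apply.
  move=> n; apply: borel_orthant_sub; first exact: measurableI.
  exact: subset_trans (@subIsetl _ _ _) KO.
exact: trivIset_setIl.
Qed.

HB.instance Definition _ :=
  isCharge.Build _ _ _ restriction restriction0 restriction_fin restriction_sigma.

Lemma signed_measure_dominated : exists2 m : {measure set borel_rV -> \bar R},
  m setT < +oo & forall A, measurable A -> `|nu (K `&` A)| <= m A.
Proof.
have [P [N PN]] := Hahn_decomposition (restriction : {charge set borel_rV -> \bar R}).
exists (charge_variation PN : {measure set borel_rV -> \bar R}).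
  by rewrite ltey_eq fin_num_measure.
by move=> A mA; exact: (abse_charge_variation PN mA).
Qed.

End Restriction.

Lemma signed_measureN nu : signed_measure borel_orthant nu ->
  signed_measure borel_orthant (fun A => - nu A).
Proof.
move=> [nu0 nuy nus]; split; first by rewrite nu0 oppe0.
  by case: nuy => H; [right|left] => A /H; case: (nu A).
move=> A mA tA.
rewrite (_ : (fun n => _) = fun n => - \sum_(0 <= k < n) nu (A k)).
  by apply: cvgeN; exact: nus.
apply: funext => n; apply: sumeN => i j _ _.
case: nuy => H; have := H _ (mA i); have := H _ (mA j);
  by case: (nu (A i)) (nu (A j)) => [r||] [s||].
Qed.

Lemma signed_measure_bounded nu K : signed_measure borel_orthant nu ->
  measurable K -> K `<=` orthant -> nu K \is a fin_num ->
  exists C : R, forall A, measurable A -> `|nu (K `&` A)| <= C%:E.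
Proof.
move=> nus mK KO Kfin; have [m mfin mP] := signed_measure_dominated nus mK KO Kfin.
exists (fine (m setT)) => A mA.
rewrite fineK ?ge0_fin_numE//; apply: le_trans (mP A mA) _.
by apply: le_measure; rewrite ?inE.
Qed.

End SignedMeasures.

(** * The signed measure generated by F^f and its bounded variations *)

Section GeneratedSignedMeasure.
Context {R : realType} {d : nat}.
Implicit Types (nu : set 'rV[R]_d -> \bar R) (f : 'rV[R]_d -> R).
Implicit Types (phi : 'rV[R]_d -> 'rV[R]_d -> R) (x y z N : 'rV[R]_d).

Lemma eq_Delta x y (f g : 'rV[R]_d -> R) : vle x y ->
  (forall z, vle x z -> vle z y -> f z = g z) -> Delta x y f = Delta x y g.
Proof.
move=> xy fg; rewrite !Delta_sum; apply: eq_bigr => J _; congr (_ * _).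
by apply: fg => i; rewrite mxE; case: ifP => // _; exact: xy.
Qed.

(** Seen from the corner (-1,...,-1), the trace on the orthant of a half-open box is the closed box
    [0,z]. The distribution function of [psi] from that corner is therefore F^f, that of the
    increments of [f] from 0, and equal distribution functions give equal box values. *)
Lemma generated_hob f nu : component_right_continuous f ->
  signed_measure borel_orthant nu ->
  (forall x, orthant x -> nu (box 0 x) = (F_ f x)%:E) ->
  forall x y, orthant x -> vle x y -> nu (hob x y) = (Delta x y f)%:E.
Proof.
move=> rf nus nuF x y x0 xy; have y0 := vle_trans x0 xy.
pose K : set (borel_rV (R := R) (d := d)) := box 0 y.
have mK : measurable K := borel_box 0 y.
have KO : K `<=` orthant by move=> z [].
have Kfin : nu K \is a fin_num by rewrite nuF.
have nufin u v : nu (K `&` hob u v) \is a fin_num.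
  apply: (signed_measure_fin_sub nus _ mK KO _ Kfin); last exact: subIsetl.
  by apply: measurableI => //; exact: borel_hob.
pose psi u v := fine (nu (K `&` hob u v)).
pose b : 'rV[R]_d := const_mx (-1).
have bx : vle b x by move=> i; rewrite mxE (le_trans _ (orthant_ge0 _ x0))// lerN10.
have psiadd : box_additive b psi.
  move=> u v i t bu uv utv; rewrite /psi (hob_split uv utv) setIUr.
  have mKh p q : measurable (K `&` hob p q : set (borel_rV (R := R) (d := d))).
    by apply: measurableI => //; exact: borel_hob.
  have KhO p q : K `&` hob p q `<=` orthant.
    by apply: subset_trans KO; exact: subIsetl.
  rewrite (signed_measureU nus) ?fineD ?nufin//.
  by rewrite setIACA hob_split_disjoint setI0.
have hxy : K `&` hob x y = hob x y.
  apply/seteqP; split => [z []//|z xzy]; split => //; split => i; case/andP: (xzy i) => xz zy //.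
  exact: le_trans (x0 i) (ltW xz).
rewrite -hxy -(fineK (nufin x y)); congr EFin.
rewrite -/(psi x y) -(Delta_base psiadd bx xy).
rewrite -[RHS](Delta_base (@Delta_additive _ _ 0 f) x0 xy).
apply: eq_Delta => // z xz zy; have z0 := vle_trans x0 xz.
rewrite -F_E// /psi (_ : K `&` hob b z = box 0 z) ?nuF//.
apply/seteqP; split => [w [[w0 _] bw]|w [w0 wz]].
  by split => // i; case/andP: (bw i).
split; first by split => //; exact: vle_trans wz zy.
by move=> i; rewrite mxE wz andbT (lt_le_trans _ (orthant_ge0 i w0))// ltrN10.
Qed.

Section HalfOpenBoxes.
Variables (nu : set 'rV[R]_d -> \bar R) (phi : 'rV[R]_d -> 'rV[R]_d -> R).
Hypotheses (nus : signed_measure borel_orthant nu) (padd : box_additive 0 phi).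
Hypotheses (nu_phi : forall x y, orthant x -> vle x y -> nu (hob x y) = (phi x y)%:E).

Lemma signed_measure_content_dominated : content_dominated 0 phi.
Proof.
(* [N] is arbitrary, so its negative coordinates are first raised to 0. *)
move=> N; pose K : set (borel_rV (R := R) (d := d)) := hob 0 (\row_i Num.max 0 (N 0 i)).
have N0 : orthant (\row_i Num.max 0 (N 0 i)).
  by apply: orthantP => i; rewrite mxE le_max lexx.
have Kfin : nu K \is a fin_num by rewrite nu_phi.
have [m mfin mP] := signed_measure_dominated nus (borel_hob _ _) (hob_orthant orthant0) Kfin.
exists (fun x y => fine (m (hob x y))); first exact: measure_box_content.
move=> x y x0 xy yN; rewrite -lee_fin fineK; last first.
  rewrite ge0_fin_numE// (le_lt_trans _ mfin)//.
  by apply: le_measure; rewrite ?inE//; exact: borel_hob.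
have := mP _ (borel_hob x y); rewrite (_ : _ `&` _ = hob x y) ?nu_phi//.
apply/seteqP; split => [z []//|z xzy]; split => // i; case/andP: (xzy i) => xz zy.
rewrite (le_lt_trans (x0 i) xz) mxE le_max (le_trans zy (yN i)).
by rewrite orbT.
Qed.

(* A collects the cells of the grid on which phi is negative. *)
Lemma cut_sum_witness L x y : orthant x -> vle x y ->
  exists A : set (borel_rV (R := R) (d := d)), [/\ measurable A, A `<=` hob x y &
    nu A = (- ((cut_sum phi L x y - phi x y) / 2))%:E].
Proof.
elim: L x y => [|[i t] L IH] x y x0 xy /=.
  have [p0|p0] := leP 0 (phi x y).
    exists set0; split; [exact: measurable0|exact: sub0set|].
    by case: nus => -> _ _; rewrite ger0_norm// subrr mul0r oppr0.
  exists (hob x y); split => //; first exact: borel_hob.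
  by rewrite nu_phi// ltr0_norm//; congr EFin; lra.
have Hi := cut_clampP i t xy; have [xy1 xy2 x2] := cut_vle x0 xy Hi.
set t' := Num.min _ _ in Hi xy1 xy2 x2 *.
have [A [mA Ah nuA]] := IH _ _ x0 xy1; have [B [mB Bh nuB]] := IH _ _ x2 xy2.
exists (A `|` B); split.
- exact: measurableU.
- by rewrite (hob_split xy Hi); exact: setUSS.
rewrite (signed_measureU nus) ?nuA ?nuB//.
- by rewrite -EFinD (padd x0 xy Hi); congr EFin; lra.
- exact: subset_trans Ah (hob_orthant x0).
- exact: subset_trans Bh (hob_orthant x2).
apply/seteqP; split => // z [/Ah zA /Bh zB].
by rewrite -(hob_split_disjoint x y i t').
Qed.

(** Inside [hob 0 N] the signed measure is bounded by some [C]. A set of measure below [-(C + 1)]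
    thus keeps measure at most -1 after that box is removed. *)
Lemma escaping_negative_set N :
  (forall M : R, exists2 x, orthant x & M < box_variation phi 0 x - phi 0 x) ->
  orthant N ->
  exists2 N', orthant N' /\ vle N N' &
    exists A : set (borel_rV (R := R) (d := d)),
      [/\ measurable A, A `<=` hob 0 N' `\` hob 0 N & (nu A <= (-1)%:E)%E].
Proof.
move=> unb N0; have Kfin : nu (hob 0 N) \is a fin_num by rewrite nu_phi.
have [C HC] := signed_measure_bounded nus (borel_hob 0 N) (hob_orthant orthant0) Kfin.
(* The factor 2 cancels the division by 2 in [cut_sum_witness]. *)
have [x x0 Hx] := unb (2 * (C + 1)).
have [L HL] : exists L, 2 * (C + 1) < cut_sum phi L 0 x - phi 0 x.
  apply: contrapT => /forallNP noL; move: Hx; apply/negP; rewrite -leNgt.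
  rewrite lerBlDr; apply: variation_le => L; rewrite -lerBlDr leNgt.
  exact/negP.
have [A [mA Ah nuA]] := cut_sum_witness L orthant0 x0.
pose N' := \row_i Num.max (N 0 i) (x 0 i).
have NN' : vle N N' by move=> i; rewrite mxE le_max lexx.
exists N'; first by split => //; exact: vle_trans NN'.
exists (A `\` hob 0 N); split.
- by apply: measurableD => //; exact: borel_hob.
- apply: setSD => z /Ah Hz i; case/andP: (Hz i) => -> zx /=.
  by rewrite mxE le_max zx orbT.
have AO : A `<=` orthant by apply: subset_trans Ah (hob_orthant orthant0).
have mAN : measurable (A `&` hob 0 N : set (borel_rV (R := R) (d := d))).
  by apply: measurableI => //; exact: borel_hob.
have mADN : measurable (A `\` hob 0 N : set (borel_rV (R := R) (d := d))).
  by apply: measurableD => //; exact: borel_hob.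
have := signed_measureU nus mAN mADN (subset_trans (@subIsetl _ _ _) AO)
  (subset_trans (@subDsetl _ _ _) AO).
rewrite setUIDK setDE setIACA setICr setI0 => /(_ erefl).
rewrite -setDE nuA.
have := HC _ mA; rewrite setIC => HCA.
have : nu (A `&` hob 0 N) \is a fin_num.
  exact: (signed_measure_fin_sub nus mAN (borel_hob 0 N) (hob_orthant orthant0) (@subIsetr _ _ _) Kfin).
move: HCA; case: (nu (A `&` hob 0 N)) => [r||]//; rewrite abse_EFin lee_fin => rC _.
case: (nu (A `\` hob 0 N)) => [s||]// [E]; rewrite lee_fin.
by move: rC; rewrite ler_norml => /andP[rC _]; lra.
Qed.

Lemma negative_variation_bounded :
  (forall A, borel_orthant A -> nu A <> -oo%E) ->
  exists M : R, forall x, orthant x -> box_variation phi 0 x - phi 0 x <= M.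
Proof.
move=> nuNy; apply: contrapT => /forallNP noM.
have unb (M : R) : exists2 x, orthant x & M < box_variation phi 0 x - phi 0 x.
  have /existsNP[x /not_implyP[x0 /negP]] := noM M; rewrite -ltNge => Hx.
  by exists x.
pose T : Type := (set (borel_rV (R := R) (d := d)) * 'rV[R]_d)%type.
(* Each new set lies in the shell between two successive boxes, which makes the sets disjoint. The
   relation is conditional because dependent choice requires a successor for every state. *)
pose next (p q : T) := orthant p.2 -> [/\ orthant q.2, vle p.2 q.2, measurable q.1,
  q.1 `<=` hob 0 q.2 `\` hob 0 p.2 & (nu q.1 <= (-1)%:E)%E].
have nextP p : {q | next p q}.
  apply: cid; have [p0|np0] := pselect (orthant p.2); last by exists p => /np0.
  have [N' [N'0 pN'] [A [mA Ah nuA]]] := escaping_negative_set unb p0.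
  by exists (A, N').
have [F [F0 FS]] := @dependent_choice T next nextP (set0, 0).
have FO n : orthant (F n).2.
  by elim: n => [|n IH]; [rewrite F0; exact: orthant0|case: (FS n IH)].
have Fmono m n : (m <= n)%N -> vle (F m).2 (F n).2.
  elim: n => [|n IH]; first by rewrite leqn0 => /eqP ->; exact: vle_refl.
  rewrite leq_eqVlt => /predU1P[->|mn]; first exact: vle_refl.
  by apply: (vle_trans (IH mn)); case: (FS n (FO n)).
pose A n := (F n.+1).1.
have mA n : borel_orthant (A n).
  have [_ _ mAn Ah _] := FS n (FO n); apply: borel_orthant_sub => //.
  by move=> z /Ah[/(hob_orthant orthant0)].
have dis m n z : (m < n)%N -> A m z -> A n z -> False.
  move=> mn; have [_ _ _ Am _] := FS m (FO m); have [_ _ _ An _] := FS n (FO n).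
  move=> /Am[zm _] /An[_]; apply => i; case/andP: (zm i) => -> /= /le_trans; apply.
  exact: Fmono mn i.
have tA : trivIset setT A.
  move=> m n _ _ [z [zm zn]]; case: (ltngtP m n) => // mn.
    by case: (dis _ _ _ mn zm zn).
  by case: (dis _ _ _ mn zn zm).
have [_ _ nusig] := nus; have H := nusig A mA tA.
have mU : borel_orthant (\bigcup_n A n) by exact: sigma_algebra_bigcup.
have sumle n : (\sum_(0 <= k < n) nu (A k) <= (- n%:R)%:E)%E.
  elim: n => [|n IH]; first by rewrite big_geq// oppr0.
  rewrite big_nat_recr//= -natr1 opprD EFinD; apply: leeD => //.
  by case: (FS n (FO n)).
have le_nu n : (nu (\bigcup_n A n) <= (- n%:R)%:E)%E.
  rewrite -(cvg_lim _ H)//; apply: lime_le; first by apply/cvg_ex; exists (nu (\bigcup_n A n)).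
  near=> k; apply: le_trans (sumle k) _; rewrite lee_fin lerN2 ler_nat.
  by near: k; exact: nbhs_infty_ge.
apply: (nuNy _ mU); move: le_nu; case: (nu _) => [r| |] // le_nu; last by have := le_nu 0%N.
have := truncnS_gt (- r); rewrite ltrNl ltNge -lee_fin.
by rewrite (le_nu (Num.truncn (- r)).+1).
Unshelve. all: by end_near. Qed.

End HalfOpenBoxes.

Lemma cut_sumN phi L x y : cut_sum (fun u v => - phi u v) L x y = cut_sum phi L x y.
Proof. by elim: L x y => [|[i t] L IH] x y /=; rewrite ?normrN// !IH. Qed.

Lemma box_variationN phi x y :
  box_variation (fun u v => - phi u v) x y = box_variation phi x y.
Proof.
by rewrite /box_variation; congr sup; apply/seteqP; split => _ [L _ <-];
  exists L => //; rewrite cut_sumN.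
Qed.

Lemma positive_variation_bounded nu phi : signed_measure borel_orthant nu ->
  box_additive 0 phi ->
  (forall x y, orthant x -> vle x y -> nu (hob x y) = (phi x y)%:E) ->
  (forall A, borel_orthant A -> nu A <> +oo%E) ->
  exists M : R, forall x, orthant x -> box_variation phi 0 x + phi 0 x <= M.
Proof.
move=> nus padd nu_phi nuy.
have [|||M HM] := @negative_variation_bounded (fun A => - nu A)%E (fun x y => - phi x y)
  (signed_measureN nus).
- by move=> x y i t *; rewrite (padd x y i t)// opprD.
- by move=> x y x0 xy; rewrite nu_phi.
- by move=> A /nuy; case: (nu A).
by exists M => x x0; have := HM x x0; rewrite box_variationN opprK.
Qed.

End GeneratedSignedMeasure.

(** * The Jordan decomposition *)

Section JordanDecomposition.
Context {R : realType} {d : nat}.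
Implicit Types (f g h : 'rV[R]_d -> R) (x y z u v : 'rV[R]_d).
Implicit Types (c phi : 'rV[R]_d -> 'rV[R]_d -> R).

Lemma bounded_on_orthantP g :
  bounded_on_orthant g <-> exists M : R, forall x, orthant x -> `|g x| <= M.
Proof.
split=> [[M [_ HM]]|[M HM]].
  by exists (M + 1) => x x0; apply: HM => //; rewrite ltrDl.
exists M; split; first exact: num_real.
by move=> K MK x x0; rewrite /= (le_trans (HM x x0))// ltW.
Qed.

Lemma grounded_vanishing g z i : grounded g -> component_right_continuous g ->
  orthant z -> z 0 i = 0 -> g z = 0.
Proof.
move=> gg rg z0 zi; have H1 := rg z i z0; have H2 := gg z i z0.
rewrite zi in H1; exact: (cvg_unique _ H1 H2).
Qed.

(** [k_increasing] speaks of positive side lengths only; on degenerate boxes the increment is 0. *)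
Lemma k_increasing_Delta_ge0 g u v : k_increasing d g -> orthant u -> vle u v ->
  0 <= Delta u v g.
Proof.
move=> dg u0 uv; have [uv'|] := pselect (forall i, u 0 i < v 0 i).
  apply: dg => //; first exact: enum_uniq.
    by rewrite -cardE cardsT card_ord.
  by move=> i; rewrite !mxE subr_gt0.
move/existsNP => [i /negP]; rewrite -leNgt => vu.
rewrite (box_additive_degenerate (@Delta_additive _ _ 0 g) u0 uv (i := i))//.
by apply/eqP; rewrite eq_le uv vu.
Qed.

Lemma VarHK_Delta_monotone g x : (0 < d)%N -> grounded g ->
  component_right_continuous g -> Delta_monotone g -> orthant x ->
  VarHK 0 x g = (g x)%:E.
Proof.
move=> d0 gg rg mg x0; apply: VarHK_increasing => //.
  by move=> z i; exact: grounded_vanishing.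
by move=> u v; apply: k_increasing_Delta_ge0; apply: mg; rewrite d0 leqnn.
Qed.

(** The variation identity determines [g x + h x], and F^f determines [g x - h x]. *)
Lemma jordan_decomposition_unique f g h g' h' x : (0 < d)%N ->
  jordan_decomposition f g h -> jordan_decomposition f g' h' -> orthant x ->
  g x = g' x /\ h x = h' x.
Proof.
move=> d0 [[gg rg mg] [gh rh mh] _ _ [Fgh VF _]].
move=> [[gg' rg' mg'] [gh' rh' mh'] _ _ [Fgh' VF' _]] x0.
have := (VF x x0).1; rewrite (VF' x x0).1 !VarHK_Delta_monotone//.
rewrite -!EFinD => -[E1]; have E2 := Fgh x x0; rewrite (Fgh' x x0) in E2.
by split; lra.
Qed.

Lemma content_cdf_rcont c : box_content 0 c -> component_right_continuous (c 0).
Proof.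
move=> cc x i x0.
have ax' : vle 0 (set_coord (0 : 'rV[R]_d) i (x 0 i)).
  by apply: vle_set_coordr; [exact: vle_refl|rewrite mxE orthant_ge0].
have ax'' : vle (set_coord (0 : 'rV[R]_d) i (x 0 i)) x by apply: vle_set_coordl.
have H := content_rcont cc i ax' ax''; rewrite set_coord_same in H.
rewrite -[X in _ --> X]addr0.
have H' : c 0 x + c (set_coord 0 i (x 0 i)) (set_coord x i t) @[t --> (x 0 i)^'+]
    --> c 0 x + 0.
  by apply: cvgD => //; exact: cvg_cst.
apply: cvg_trans H'; apply: near_eq_cvg; near=> t.
have xt : x 0 i <= t by apply: ltW; near: t; exact: nbhs_right_gt.
rewrite /= (content_add cc (y := set_coord x i t) (i := i) (t := x 0 i) (vle_refl _)).
- by rewrite set_coord_twice set_coord_id.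
- by apply: vle_set_coordr => //; rewrite mxE (le_trans _ xt)// orthant_ge0.
- by rewrite set_coord_same xt mxE orthant_ge0.
Unshelve. all: by end_near. Qed.

Lemma content_cdf_grounded c : box_content 0 c -> grounded (c 0).
Proof.
move=> cc x i x0; have := content_rcont cc i (vle_refl _) x0.
by rewrite mxE.
Qed.

Lemma content_cdf_monotone c : box_content 0 c -> Delta_monotone (c 0).
Proof.
move=> cc k _ s x e us _ x0 e0.
rewrite (iter_diff_base (content_add cc) us x0); last by move=> i _; exact: ltW.
apply: (content_ge0 cc) => i; rewrite !mxE; case: ifP => // _; rewrite ?orthant_ge0//.
by rewrite lerDl ltW.
Qed.

Lemma content_cdf0 c : (0 < d)%N -> box_content 0 c -> c 0 0 = 0.
Proof.
move=> d0 cc.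
exact: (box_additive_degenerate (content_add cc) (vle_refl _) (vle_refl _) (i := Ordinal d0)).
Qed.

Lemma generates_jordan f : (0 < d)%N -> component_right_continuous f ->
  generates_signed_measure (F_ f) -> exists g h, jordan_decomposition f g h.
Proof.
move=> d0 rf [nu nus nuF]; pose phi x y := Delta x y f.
have padd : box_additive 0 phi by exact: Delta_additive.
have nu_phi := generated_hob rf nus nuF.
have pdom : content_dominated 0 phi := signed_measure_content_dominated nus nu_phi.
pose V := box_variation phi.
have cV : box_content 0 V := variation_content padd pdom.
pose cg x y := 2^-1 * (V x y + phi x y); pose ch x y := 2^-1 * (V x y + -1 * phi x y).
have normV x y : orthant x -> vle x y -> `|phi x y| <= V x y.
  exact: variation_ge_norm.
have ccg : box_content 0 cg.
  split.
  - move=> x y x0 xy; have := normV x y x0 xy; rewrite ler_norml => /andP[? _].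
    by rewrite /cg mulr_ge0//; lra.
  - by apply/box_additiveZ/box_additiveD => //; exact: content_add.
  - move=> x y i x0 xy; rewrite -(mulr0 2^-1); apply: cvgMr.
    rewrite -[X in _ --> X](addr0 0); apply: cvgD; first exact: (content_rcont cV).
    exact: Delta_coord_rcont.
have cch : box_content 0 ch.
  split.
  - move=> x y x0 xy; have := normV x y x0 xy; rewrite ler_norml => /andP[_ ?].
    by rewrite /ch mulr_ge0//; lra.
  - by apply/box_additiveZ/box_additiveD; [exact: content_add|exact: box_additiveZ].
  - move=> x y i x0 xy; rewrite -(mulr0 2^-1); apply: cvgMr.
    rewrite -[X in _ --> X](addr0 0); apply: cvgD; first exact: (content_rcont cV).
    rewrite -(mulr0 (-1)); apply: cvgMr; exact: Delta_coord_rcont.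
have FE x : orthant x -> F_ f x = phi 0 x by move=> x0; rewrite F_E.
exists (cg 0), (ch 0).
have rg := content_cdf_rcont ccg; have rh := content_cdf_rcont cch.
have gg := content_cdf_grounded ccg; have gh := content_cdf_grounded cch.
have mg := content_cdf_monotone ccg; have mh := content_cdf_monotone cch.
split => //.
(* Omitting [+oo] bounds the positive variation, which is [g]; omitting [-oo] bounds the negative
   one, [h]. *)
- case: (nus) => _ [nuy|nuNy] _; [left|right]; apply/bounded_on_orthantP.
    have [M HM] := positive_variation_bounded nus padd nu_phi nuy.
    exists M => x x0; have /andP[H1 H2] : 0 <= V 0 x + phi 0 x <= M.
      rewrite HM// andbT; have := normV 0 x orthant0 x0.
      by rewrite ler_norml => /andP[? _]; lra.
    by rewrite /cg ger0_norm ?mulr_ge0//; lra.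
  have [M HM] := negative_variation_bounded nus padd nu_phi nuNy.
  exists M => x x0; have /andP[H1 H2] : 0 <= V 0 x - phi 0 x <= M.
    rewrite HM// andbT; have := normV 0 x orthant0 x0.
    by rewrite ler_norml => /andP[_ ?]; lra.
  by rewrite /ch mulN1r ger0_norm ?mulr_ge0//; lra.
- by rewrite !content_cdf0.
split.
- by move=> x x0; rewrite FE// /cg /ch; lra.
- move=> x x0; rewrite (VarHK_Delta_monotone d0 gg rg mg x0) (VarHK_Delta_monotone d0 gh rh mh x0).
  rewrite -EFinD ltry; split => //.
  rewrite (@VarHK_variation _ _ phi)//.
  + by congr EFin; rewrite /cg /ch -/V; lra.
  + move=> z i z0; rewrite FE//.
    have H := Delta_rcont_upper i rf orthant0 z0.
    apply: cvg_trans H; apply: near_eq_cvg; near=> t; rewrite FE//; apply: orthant_set_coord => //.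
    rewrite (le_trans (orthant_ge0 i z0))// ltW//; near: t; exact: nbhs_right_gt.
  + move=> z i z0 zi; rewrite FE//.
    by apply: (box_additive_degenerate padd _ z0 (i := i)) => //; rewrite mxE zi.
  + move=> u v u0 uv; rewrite (@eq_Delta _ _ u v (F_ f) (phi 0))//.
      exact: Delta_base.
    by move=> z uz _; rewrite FE//; exact: vle_trans uz.
- move=> x y x0 xy; rewrite !Delta_base//; [|exact: content_add|exact: content_add].
  by rewrite /cg /ch /phi; lra.
Unshelve. all: by end_near. Qed.

End JordanDecomposition.

(** * The measure generated by a content *)

Section ContentMeasure.
Context {R : realType} {d : nat}.
Local Open Scope ereal_scope.
Implicit Types (x y z u v : 'rV[R]_d) (i : 'I_d) (t : R) (A X : set 'rV[R]_d).

Definition positive_quadrant : set 'rV[R]_d := [set z | forall i, (0 < z 0 i)%R].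

Lemma hob_positive x y : orthant x -> hob x y `<=` positive_quadrant.
Proof.
move=> x0 z xzy i; case/andP: (xzy i) => xz _; exact: le_lt_trans (orthant_ge0 i x0) xz.
Qed.

(* Every set is measurable here, so that the library's outer measure generated
   by a premeasure applies to the set function [hob_cost]. *)
Let discrete := g_sigma_algebraType [set: set 'rV[R]_d].

Let measurable_discrete (A : set discrete) : measurable A.
Proof. exact: sub_sigma_algebra. Qed.

Variable c : 'rV[R]_d -> 'rV[R]_d -> R.
Hypotheses (d0 : (0 < d)%N) (cc : box_content 0 c).

(** The price of covering [A] by a single box, [+oo] if no box suffices; [mu_ext] adds the countable
    covers. Only the part of [A] in the open quadrant has to be covered, so the faces become null
    sets. *)
Let hob_cost (A : set discrete) : \bar R :=
  ereal_inf [set (c p.1 p.2)%:E | p in [set p | [/\ orthant p.1, vle p.1 p.2 &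
    A `&` positive_quadrant `<=` hob p.1 p.2]]].

Let hob_cost_ge0 A : 0 <= hob_cost A.
Proof.
by apply: le_ereal_inf_tmp => _ [p [p0 p12 _] <-]; rewrite lee_fin (content_ge0 cc).
Qed.

Let hob_cost_le A u v : orthant u -> vle u v ->
  A `&` positive_quadrant `<=` hob u v -> hob_cost A <= (c u v)%:E.
Proof. by move=> u0 uv Auv; apply: ereal_inf_lbound; exists (u, v). Qed.

Let hob_cost_eq0 A : A `&` positive_quadrant = set0 -> hob_cost A = 0.
Proof.
move=> A0; apply/eqP; rewrite eq_le hob_cost_ge0 andbT.
have -> : (0 = (c 0 0)%:E :> \bar R)%E.
  by rewrite (box_additive_degenerate (content_add cc) (i := Ordinal d0)).
by apply: hob_cost_le => //; rewrite A0; exact: sub0set.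
Qed.

Let hob_cost0 : hob_cost set0 = 0.
Proof. by rewrite hob_cost_eq0// set0I. Qed.

Let outer : set 'rV[R]_d -> \bar R := mu_ext hob_cost.

HB.instance Definition _ := isOuterMeasure.Build R 'rV[R]_d outer
  (@mu_ext0 _ discrete R hob_cost hob_cost0 hob_cost_ge0)
  (@mu_ext_ge0 _ discrete R hob_cost hob_cost_ge0)
  (@le_mu_ext _ discrete R hob_cost)
  (@mu_ext_sigma_subadditive _ discrete R hob_cost hob_cost_ge0).

Let outer_le A : outer A <= hob_cost A.
Proof.
apply: ereal_inf_lbound; exists (fun n : nat => if n == 0%N then A else set0).
  split; first by move=> n; exact: measurable_discrete.
  by move=> z Az; exists 0%N.
apply/cvg_lim => //; apply: cvg_near_cst; exists 1%N => // -[//|n] _ /=.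
by rewrite big_nat_recl// big1 ?adde0.
Qed.

Let hob_cost_split A i t :
  hob_cost (A `&` [set z | (z 0 i <= t)%R]) +
  hob_cost (A `&` ~` [set z | (z 0 i <= t)%R]) <= hob_cost A.
Proof.
apply: le_ereal_inf_tmp => _ [[u v] [/= u0 uv Auv] <-].
have Hi := cut_clampP i t uv; have [uv1 uv2 u2] := cut_vle u0 uv Hi.
set s := Num.min _ _ in Hi uv1 uv2 u2.
rewrite (content_add cc u0 uv Hi) EFinD; apply: leeD; apply: hob_cost_le => //.
- move=> z [[Az zt] zp] j; have H := Auv z (conj Az zp); rewrite set_coordE.
  case: eqP => [->|_]; last exact: H.
  by case/andP: (H i) => -> zv; rewrite /s le_min zv le_max zt.
- move=> z [[Az /negP]]; rewrite -ltNge => tz zp j; have H := Auv z (conj Az zp).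
  rewrite set_coordE; case: eqP => [->|_]; last exact: H.
  by case/andP: (H i) => uz ->; rewrite andbT /s gt_min gt_max tz uz.
Qed.

Let cara_coord i t : outer.-caratheodory [set z | (z 0 i <= t)%R].
Proof.
apply: (@le_caratheodory_measurable _ _ outer) => X; set H := [set z | _].
apply: le_ereal_inf_tmp => _ [F [_ XF] <-].
have cov (S : set 'rV[R]_d) : outer (X `&` S) <= \sum_(k <oo) hob_cost (F k `&` S).
  apply: ereal_inf_lbound; exists (fun k => F k `&` S) => //.
  split; first by move=> n; exact: measurable_discrete.
  by move=> z [/XF[k _ Fkz] Sz]; exists k.
apply: le_trans (leeD (cov H) (cov (~` H))) _.
rewrite -nneseriesD//; apply: lee_nneseries => [k _ _|k _].
  by rewrite adde_ge0.
exact: hob_cost_split.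
Qed.

Let cara_hob x y :
  measurable (hob x y : set (caratheodory_type outer)).
Proof.
have mle i t : measurable ([set z | (z 0 i <= t)%R] : set (caratheodory_type outer)).
  exact: cara_coord.
rewrite (_ : hob x y = \bigcap_(i in [set: 'I_d])
  (~` [set z | (z 0 i <= x 0 i)%R] `&` [set z | (z 0 i <= y 0 i)%R])).
  apply: fin_bigcap_measurable => [|i _]; first exact: finite_finset.
  by apply: measurableI => //; exact: measurableC.
apply/seteqP; split=> [z xzy i _|z Hz i].
  by case/andP: (xzy i) => xz zy; split => //=; apply/negP; rewrite -ltNge.
by have [/= /negP] := Hz i I; rewrite -ltNge => -> ->.
Qed.

(** An open set is the union of the half-open boxes with rational corners that it contains, and
    these are countably many. *)
Let cara_open U : open U -> outer.-caratheodory U.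
Proof.
move=> oU; pose I := ('rV[rat]_d * 'rV[rat]_d)%type.
pose q2r (q : 'rV[rat]_d) : 'rV[R]_d := map_mx ratr q.
pose E n := if (unpickle n : option I) is Some q then
  if `[< hob (q2r q.1) (q2r q.2) `<=` U >] then hob (q2r q.1) (q2r q.2) else set0
  else set0.
suff -> : U = \bigcup_n E n.
  apply: (@bigcupT_measurable _ (caratheodory_type outer)) => n; rewrite /E.
  case: unpickle => [q|]; last exact: measurable0.
  by case: ifP => _; [exact: cara_hob|exact: measurable0].
apply/seteqP; split=> [z Uz|z [n _]]; last first.
  by rewrite /E; case: unpickle => // q; case: asboolP => // H /H.
have /nbhs_ballP[e /= e0 eU] : nbhs z U by exact: open_nbhs_nbhs.
have /choice[q Hq] : forall i, exists q : rat, (z 0 i - e < ratr q < z 0 i)%R.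
  move=> i; have ze : (z 0 i - e < z 0 i)%R by rewrite ltrBlDr ltrDl.
  have [q] := rat_in_itvoo ze; rewrite in_itv/= => H; by exists q.
have /choice[r Hr] : forall i, exists r : rat, (z 0 i < ratr r < z 0 i + e)%R.
  move=> i; have ze : (z 0 i < z 0 i + e)%R by rewrite ltrDl.
  have [r] := rat_in_itvoo ze; rewrite in_itv/= => H; by exists r.
pose p : I := (\row_i q i, \row_i r i).
exists (pickle p) => //; rewrite /E pickleK.
case: asboolP => [_ i|[]].
  by rewrite !mxE; case/andP: (Hq i) => _ ->; case/andP: (Hr i) => /ltW.
move=> w Hw; apply: eU; split => // i j; rewrite ord1 /ball/=.
have := Hw j; rewrite !mxE => /andP[qw wr].
case/andP: (Hq j) => q1 _; case/andP: (Hr j) => _ r1.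
by rewrite ltr_norml; apply/andP; split; lra.
Qed.

Let outer_hob_ge x y : orthant x -> vle x y -> (c x y)%:E <= outer (hob x y).
Proof.
move=> x0 xy; have [lt|] := pselect (forall i, (x 0 i < y 0 i)%R); last first.
  move=> /existsNP[i /negP]; rewrite -leNgt => yx.
  rewrite (box_additive_degenerate (content_add cc) x0 xy (i := i)).
    exact: mu_ext_ge0.
  by apply/eqP; rewrite eq_le yx xy.
apply: le_ereal_inf_tmp => _ [F [_ hF] <-].
(* A covering set of infinite cost makes the bound trivial; otherwise near-optimal boxes exist. *)
have [[k koo]|Foo] := pselect (exists k, hob_cost (F k) = +oo).
  by rewrite (eseries_pinfty _ _ koo) ?leey// => n _; rewrite -ltNye (lt_le_trans _ (hob_cost_ge0 _)).
apply/lee_addgt0Pr => e e0; have e20 : (0 < e / 2)%R by rewrite divr_gt0.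
have [x' [xx' x'y cx']] := content_inner_approx cc x0 lt e20.
(* These errors sum to [e / 2]; the other half of [e] was spent on [x']. *)
pose w k : R := (e / 2 / (2 ^ k.+1)%:R)%R.
have w0 k : (0 < w k)%R by rewrite divr_gt0// ltr0n expn_gt0.
have /choice[p Hp] : forall k, exists p : 'rV[R]_d * 'rV[R]_d,
    [/\ orthant p.1, vle p.1 p.2,
       F k `&` positive_quadrant `<=` [set z | forall i, (p.1 0 i < z 0 i < p.2 0 i)%R] &
       (c p.1 p.2)%:E <= hob_cost (F k) + (w k)%:E].
  (* Half of [w k] pays for a near-optimal box, half for enlarging it to an open one. *)
  move=> k; have w20 : (0 < w k / 2)%R by rewrite divr_gt0.
  have Fk : hob_cost (F k) \is a fin_num.
    rewrite ge0_fin_numE// ltey; apply/eqP => Fk; apply: Foo; by exists k.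
  have [_ [[u v] [/= u0 uv Fuv] <-] cuv] := lb_ereal_inf_adherent w20 Fk.
  have [v' [vv' cv']] := content_outer_approx cc u0 uv w20.
  exists (u, v'); split => //=.
  - by move=> i; rewrite (le_trans (uv i))// ltW.
  - by move=> z /Fuv zuv i; case/andP: (zuv i) => -> /= /le_lt_trans; apply.
  - move: cuv; rewrite -/(hob_cost (F k)) -(fineK Fk) -!EFinD lte_fin lee_fin => cuv.
    by lra.
have : compact [set z : 'rV[R]_d | forall i : 'I_d, `[x' 0%R i, y 0%R i]%classic (z ord0 i)].
  apply: (@rV_compact R d (fun i : 'I_d => `[x' 0%R i, y 0%R i]%classic)) => i.
  exact: segment_compact.
rewrite compact_cover => /(_ nat setT (fun k => [set z | forall i, ((p k).1 0 i < z 0 i < (p k).2 0 i)%R])).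
case.
- move=> k _; rewrite openE => z Hz.
  have Hi i : nbhs z [set w : 'rV[R]_d | ((p k).1 0 i < w 0 i < (p k).2 0 i)%R].
    have oi : open ([set w : 'rV[R]_d | ((p k).1 0 i < w 0 i)%R] `&`
                    [set w | (w 0 i < (p k).2 0 i)%R]).
      by apply: openI; [exact: open_coord_gt|exact: open_coord_lt].
    have N := open_nbhs_nbhs (conj oi (andP (Hz i))).
    by apply: filterS N => v [/= -> ->].
  exact: (@filter_forall _ 'I_d (fun i => [set w : 'rV[R]_d |
    ((p k).1 0 i < w 0 i < (p k).2 0 i)%R]) (nbhs z) _ Hi).
- move=> z Hz; have hz : hob x y z.
    move=> i; have := Hz i; rewrite /= in_itv/= => /andP[xz ->].
    by rewrite (lt_le_trans (xx' i) xz).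
  have [k _ Fkz] := hF _ hz; exists k => //.
  have [_ _ H _] := Hp k; apply: H; split => //; exact: hob_positive hz.
move=> D _ cov.
have x'0 : vle 0 x' by move=> i; rewrite (le_trans (x0 i))// ltW.
have := @content_cover _ _ 0 c x' y [seq p k | k <- finmap.enum_fset D] (content_add cc) (content_ge0 cc) x'0 x'y.
have H1 : forall q, q \in [seq p k | k <- finmap.enum_fset D] -> vle 0 q.1 /\ vle q.1 q.2.
  by move=> _ /mapP[k _ ->]; have [? ? _ _] := Hp k.
have H2 z : hob x' y z -> exists2 q, q \in [seq p k | k <- finmap.enum_fset D] & hob q.1 q.2 z.
  move=> xzy; have [i|k /= kD Hk] := cov z.
    by rewrite /= in_itv/=; case/andP: (xzy i) => /ltW -> ->.
  exists (p k); first exact: map_f.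
  by move=> i; case/andP: (Hk i) => -> /ltW.
move=> /(_ H1 H2); rewrite big_map => cD.
have -> : e%:E = (e / 2)%:E + (e / 2)%:E by rewrite -EFinD -splitr.
rewrite addeA -leeBlDr//.
apply: le_trans (epsilon_trick xpredT (fun k => hob_cost_ge0 (F k)) (ltW e20)).
rewrite -EFinB; apply: (@le_trans _ _ (\sum_(k <- finmap.enum_fset D) c (p k).1 (p k).2)%:E).
  by rewrite lee_fin lerBlDr (le_trans cx')// lerD2r.
(* The subcover selects finitely many terms of a nonnegative series, which is best compared with its
   unordered sum. *)
rewrite -sumEFin nneseries_esum//; last first.
  by move=> k _; apply: adde_ge0 => //; rewrite lee_fin; exact: ltW (w0 k).
apply: esum_ge; exists [set` finmap.enum_fset D].
  by split => //; exact: finite_seq.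
rewrite -fsbig_seq ?finmap.fset_uniq//.
by apply: lee_sum => k _; have [_ _ _] := Hp k.
Qed.

Let borel_cara (A : set (borel_rV (R := R) (d := d))) : measurable A ->
  measurable (A : set (caratheodory_type outer)).
Proof.
move: A; apply: smallest_sub; last exact: cara_open.
split; first exact: measurable0.
- by move=> A mA; rewrite setTD; exact: measurableC.
- by move=> F mF; exact: bigcupT_measurable.
Qed.

Let measure_of_content (A : set (borel_rV (R := R) (d := d))) : \bar R := outer A.

Let measure_of_content_sigma : semi_sigma_additive measure_of_content.
Proof.
move=> F mF tF mU; apply: (@caratheodory_measure_sigma_additive _ _ outer) => //.
  by move=> n; exact: borel_cara.
exact: borel_cara.
Qed.

HB.instance Definition _ := isMeasure.Build _ (borel_rV (R := R) (d := d)) R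
  measure_of_content (outer_measure0 outer) (outer_measure_ge0 outer)
  measure_of_content_sigma.

Lemma content_extension : exists mu : {measure set (borel_rV (R := R) (d := d)) -> \bar R},
  (forall x y, orthant x -> vle x y -> mu (hob x y) = (c x y)%:E) /\
  mu (~` positive_quadrant) = 0.
Proof.
exists (measure_of_content : {measure set _ -> \bar R}); split => [x y x0 xy|].
  apply/eqP; rewrite eq_le outer_hob_ge// andbT.
  by apply: le_trans (outer_le _) _; apply: hob_cost_le => //; exact: subIsetl.
apply/eqP; rewrite eq_le measure_ge0 andbT.
apply: le_trans (outer_le _) _; rewrite hob_cost_eq0//.
by rewrite setICl.
Qed.

End ContentMeasure.

(** * From a decomposition of the increments to an inducing signed measure *)

Section DecompositionMeasure.
Context {R : realType} {d : nat}.
Implicit Types (f g h : 'rV[R]_d -> R) (x y z u v : 'rV[R]_d).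
Local Notation borel := (borel_rV (R := R) (d := d)).

Lemma borel_positive_quadrant : measurable (positive_quadrant : set borel).
Proof.
by apply: (borel_forall (A := fun i => [set z | 0 < z 0 i])) => i; exact: borel_coord_gt.
Qed.

Lemma borel_orthant_borel (A : set borel) : borel_orthant A -> measurable A.
Proof.
have mO : measurable (orthant : set borel).
  apply: (borel_forall (A := fun i => [set z | (0 : 'rV[R]_d) 0 i <= z 0 i])) => i.
  exact: borel_coord_ge.
move: A; apply: smallest_sub => [|_ [U oU <-]].
  split; first exact: measurable0.
  - by move=> A mA; exact: measurableD.
  - by move=> F mF; exact: bigcupT_measurable.
by apply: measurableI => //; exact: sub_sigma_algebra.
Qed.

(** Finiteness of one of the two measures excludes the indeterminate difference of infinities. *)
Lemma signed_measureB (m1 m2 : {measure set borel -> \bar R}) :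
  (m1 setT < +oo)%E \/ (m2 setT < +oo)%E ->
  signed_measure borel_orthant (fun A => (m1 A - m2 A)%E).
Proof.
have finT (m : {measure set borel -> \bar R}) A : (m setT < +oo)%E -> measurable A ->
    m A \is a fin_num.
  move=> mT mA; rewrite ge0_fin_numE// (le_lt_trans _ mT)//.
  by apply: le_measure; rewrite ?inE.
move=> mfin.
have compat A B : measurable A -> measurable B -> (m1 A +? - m2 B)%E.
  case: mfin => mT mA mB.
    by rewrite fin_num_adde_defr// finT.
  by rewrite fin_num_adde_defl// fin_numN finT.
split; first by rewrite !measure0 sube0.
  have ge0 (m : {measure set borel -> \bar R}) A : (0 <= m A)%E by [].
  case: mfin => mT; [left|right] => A /borel_orthant_borel mA.
    have := finT m1 A mT mA; have := ge0 m2 A.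
    by case: (m1 A) (m2 A) => [r||] [s||].
  have := finT m2 A mT mA; have := ge0 m1 A.
  by case: (m2 A) (m1 A) => [r||] [s||].
move=> F mF tF; have {}mF n := borel_orthant_borel (mF n).
have mU : measurable (\bigcup_n F n : set borel) by exact: bigcupT_measurable.
rewrite (_ : (fun n => _) = fun n =>
    (\sum_(0 <= k < n) m1 (F k) - \sum_(0 <= k < n) m2 (F k))%E).
  by apply: cvgeB; [exact: compat|exact: measure_semi_sigma_additive|
    exact: measure_semi_sigma_additive].
apply: funext => n; rewrite big_split/=; congr (_ + _)%E.
by rewrite sumeN// => i j _ _; rewrite ge0_adde_def// inE.
Qed.

Lemma k_increasing_content g : component_right_continuous g -> k_increasing d g ->
  box_content 0 (fun x y => Delta x y g).
Proof.
move=> rg dg; split.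
- by move=> x y; exact: k_increasing_Delta_ge0.
- exact: Delta_additive.
- by move=> x y i; exact: Delta_coord_rcont.
Qed.

Lemma shrunk_vle x y (p : 'I_d + 'I_d -> R) : orthant x -> vle x y ->
  (forall w, 0 <= p w) ->
  vle (\row_i Num.max 0 (x 0 i - p (inl i))) (\row_i (y 0 i + p (inr i))).
Proof.
move=> x0 xy p0 i; rewrite !mxE ge_max.
have y0 := le_trans (orthant_ge0 i x0) (xy i).
rewrite addr_ge0//= (le_trans _ (lerD (xy i) (p0 (inr i))))//.
by rewrite lerD2l oppr_le0.
Qed.

Section BoxLimits.
Variables (g : 'rV[R]_d -> R) (mu : {measure set borel -> \bar R}).
Hypothesis mu_hob : forall x y, orthant x -> vle x y -> mu (hob x y) = (Delta x y g)%:E.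
Hypothesis mu_face : mu (~` positive_quadrant) = 0%E.

Lemma measure_positive (A : set borel) : measurable A ->
  mu A = mu (positive_quadrant `&` A).
Proof.
move=> mA; have mP := borel_positive_quadrant.
rewrite -[in LHS](setUIDK A positive_quadrant) measureU.
- rewrite setIC [X in (_ + X)%E](_ : _ = 0%E) ?adde0//.
  apply/eqP; rewrite eq_le measure_ge0 andbT -mu_face.
  apply: le_measure; rewrite ?inE; first exact: measurableD.
    exact: measurableC.
  by move=> z [].
- exact: measurableI.
- exact: measurableD.
- by rewrite setDE setIACA setICr setI0.
Qed.

(** The cubes from 0 to (n,...,n) exhaust the quadrant, and each increment is an alternating sum of
    2^d values of [g]. *)
Lemma measure_bounded : bounded_on_orthant g -> (mu setT < +oo)%E.
Proof.
move=> /bounded_on_orthantP[M HM]; pose N n : 'rV[R]_d := const_mx n%:R.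
have N0 n : orthant (N n) by apply: orthantP => i; rewrite mxE.
rewrite measure_positive// setIT.
have PE : positive_quadrant = \bigcup_n hob 0 (N n).
  apply/seteqP; split => [z z0|z [n _ Hz]]; last exact: hob_positive orthant0 _ Hz.
  exists (\max_(j < d) (Num.truncn (z 0%R j)).+1)%N => // i; rewrite !mxE z0/=.
  have : ((Num.truncn (z 0%R i)).+1 <= \max_(j < d) (Num.truncn (z 0%R j)).+1)%N.
    exact: leq_bigmax.
  rewrite -(ler_nat R); apply: le_trans.
  exact/ltW/truncnS_gt.
have cN : (mu \o (fun n => hob 0 (N n))) n @[n --> \oo] --> mu positive_quadrant.
  rewrite PE; apply: nondecreasing_cvg_mu.
  - by move=> n; exact: borel_hob.
  - by rewrite -PE; exact: borel_positive_quadrant.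
  - move=> m n mn; apply/subsetPset => z Hz i; case/andP: (Hz i) => -> /=.
    by rewrite !mxE => /le_trans; apply; rewrite ler_nat.
apply: (@le_lt_trans _ _ (2 ^+ d * M)%:E); last by rewrite ltry.
rewrite -(cvg_lim _ cN)//; apply: lime_le.
  by apply/cvg_ex; exists (mu positive_quadrant).
near=> n; rewrite /= (mu_hob orthant0 (N0 n)) lee_fin.
apply: le_trans (ler_norm _) _; rewrite /Delta /Delta_on.
apply: le_trans (iter_diff_bound HM orthant0 _) _.
  by move=> i _; rewrite !mxE subr0.
by rewrite -cardE cardsT card_ord.
Unshelve. all: by end_near. Qed.

Variables (x y : 'rV[R]_d).
Hypotheses (x0 : orthant x) (xy : vle x y).

(* The constraint on z_i coming from delta_i (w = inl i) or epsilon_i (w = inr i),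
   after (b = true) or before (b = false) the limit in that variable is taken. *)
Let side (w : 'I_d + 'I_d) (b : bool) (q : R) (z : 'rV[R]_d) : Prop :=
  match w with
  | inl i => if b then x 0 i <= z 0 i else x 0 i - q < z 0 i
  | inr i => z 0 i <= y 0 i + (if b then 0 else q)
  end.

(** The set whose measure is the value of the inner limits over [s], the other variables being given
    by [p]. For empty [s] it is the half-open box of [G]; for the full list it is the part of
    [box x y] in the open quadrant. *)
Let stage (s : seq ('I_d + 'I_d)) (p : 'I_d + 'I_d -> R) : set borel :=
  positive_quadrant `&` [set z | forall w, side w (w \in s) (p w) z].

Let side_limit w z q : (forall t, 0 < t -> side w false t z) <-> side w true q z.
Proof.
case: w => i /=; split=> H.
- rewrite leNgt; apply/negP => zx; have := H (x 0 i - z 0 i).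
  by rewrite subr_gt0 => /(_ zx); rewrite opprB addrC subrK ltxx.
- by move=> t t0; rewrite (lt_le_trans _ H)// ltrBlDr ltrDl.
- rewrite addr0 leNgt; apply/negP => yz; have := H ((z 0 i - y 0 i) / 2).
  by rewrite divr_gt0 ?subr_gt0// => /(_ isT); lra.
- by move=> t t0; rewrite (le_trans H)// addr0 lerDl ltW.
Qed.

Let side_mono w b q q' z : q <= q' -> side w b q z -> side w b q' z.
Proof.
case: w => i /= qq'; case: b => //.
  by move=> H; apply: le_lt_trans H; rewrite lerD2l lerN2.
by move=> H; apply: (le_trans H); rewrite lerD2l.
Qed.

Let stage_measurable s p : measurable (stage s p).
Proof.
apply: measurableI; first exact: borel_positive_quadrant.
apply: (borel_forall (A := fun w => side w (w \in s) (p w))) => -[i|i] /=.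
  by case: (_ \in s); [exact: borel_coord_ge|exact: borel_coord_gt].
exact: borel_coord_le.
Qed.

Let stage_fin s p : (forall w, 0 <= p w) -> (mu (stage s p) < +oo)%E.
Proof.
move=> p0; pose N := \row_i (y 0 i + p (inr i)).
have N0 : orthant N.
  by apply: orthantP => i; rewrite mxE addr_ge0// (le_trans (orthant_ge0 i x0)).
apply: (@le_lt_trans _ _ (mu (hob 0 N))); last by rewrite mu_hob ?ltry//; exact: orthant0.
apply: le_measure; rewrite ?inE; [exact: stage_measurable|exact: borel_hob|].
move=> z [z0 Hz] i; rewrite !mxE z0 /=; have := Hz (inr i) => /= /le_trans; apply.
by rewrite lerD2l; case: ifP.
Qed.

Let stage_limit (v : 'I_d + 'I_d) s p : v \notin s ->
  \bigcap_(t in [set t | 0 < t]) stage s (assign p v t) = stage (v :: s) p.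
Proof.
move=> vs; apply/seteqP; split => [z Hz|z [z0 Hz] t /= t0].
  split=> [|w]; first by case: (Hz 1 ltr01).
  rewrite inE; have [->|wv] := eqVneq w v; rewrite ?orTb ?orFb.
    apply/side_limit => t t0; have [_ /(_ v)] := Hz t t0.
    by rewrite (negbTE vs) /assign eqxx.
  by have [_ /(_ w)] := Hz 1 ltr01; rewrite /assign (negbTE wv).
split=> // w; rewrite /assign; have := Hz w; rewrite inE.
have [->|wv] := eqVneq w v; rewrite ?orTb ?orFb//.
by rewrite (negbTE vs) => /side_limit; apply.
Qed.

Let G p := Delta (\row_i Num.max 0 (x 0 i - p (inl i))) (\row_i (y 0 i + p (inr i))) g.

(** Each one-variable limit is continuity from above of [mu] along a decreasing family of stages. *)
Lemma iter_lim_stage s p : uniq s -> (forall w, 0 <= p w) ->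
  iter_lim (fun=> 0) s G p (fine (mu (stage s p))).
Proof.
elim: s p => [|v s IH] p.
  move=> _ p0 /=; rewrite (_ : stage [::] p =
    hob (\row_i Num.max 0 (x 0 i - p (inl i))) (\row_i (y 0 i + p (inr i)))).
    rewrite mu_hob//; first by apply: orthantP => i; rewrite mxE le_max lexx.
    exact: shrunk_vle.
  apply/seteqP; split => [z [z0 Hz] i|z Hz].
    rewrite !mxE gt_max z0/=; apply/andP; split; first exact: (Hz (inl i)).
    exact: (Hz (inr i)).
  split=> [i|[i|i]] /=; have := Hz i; rewrite !mxE gt_max => /andP[/andP[? ?] ?] //.
move=> /= /andP[vs us] p0; exists (fun t => fine (mu (stage s (assign p v t)))).
have p0' t : 0 <= t -> forall w, 0 <= assign p v t w.
  by move=> t0 w; rewrite /assign; case: eqP.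
split.
  near=> t; apply: IH => //; apply: p0'; apply: ltW; near: t; exact: nbhs_right_gt.
rewrite -stage_limit//; apply: (@cvg_measure_at_right _ _ _ mu _ 0 1).
- exact: ltr01.
- by move=> t _; exact: stage_measurable.
- move=> t t' t0 tt' z [z0 Hz]; split => // w; apply: side_mono (Hz w).
  by rewrite /assign; case: eqP.
- by apply: stage_fin; exact: p0'.
Unshelve. all: by end_near. Qed.

(** A stage depends on the list only through membership, so all orders of the limits end in the same
    set. *)
Lemma is_D_measure : is_D g x y (fine (mu (box x y))) /\ mu (box x y) \is a fin_num.
Proof.
have boxE s : perm_eq s (enum {: 'I_d + 'I_d}) ->
    mu (box x y) = mu (stage s (fun=> 0)).
  move=> ps; have ins w : w \in s by rewrite (perm_mem ps) mem_enum.
  rewrite measure_positive; last exact: borel_box.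
  congr (mu _); apply/seteqP; split => z [z0 Hz]; split => //.
    by case: Hz => xz zy [i|i] /=; rewrite ins ?addr0; [exact: xz|exact: zy].
  by split=> i; [have := Hz (inl i)|have := Hz (inr i)]; rewrite /= ins ?addr0.
split=> [s ps|]; last first.
  by rewrite (boxE _ (perm_refl _)) ge0_fin_numE// stage_fin.
by rewrite (boxE s ps); apply: iter_lim_stage => //; rewrite (perm_uniq ps) enum_uniq.
Qed.

End BoxLimits.

Lemma decomposition_measure_inducing f g h : (0 < d)%N ->
  component_right_continuous g -> k_increasing d g ->
  component_right_continuous h -> k_increasing d h ->
  bounded_on_orthant g \/ bounded_on_orthant h ->
  Delta_decomposition f g h -> measure_inducing f.
Proof.
move=> d0 rg dg rh dh bnd fgh.
have [mg [mg_hob mg0]] := content_extension d0 (k_increasing_content rg dg).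
have [mh [mh_hob mh0]] := content_extension d0 (k_increasing_content rh dh).
exists (fun A => (mg A - mh A)%E).
  apply: signed_measureB; case: bnd => b; [left|right].
    exact: (measure_bounded mg_hob mg0).
  exact: (measure_bounded mh_hob mh0).
move=> x y x0 xy.
have [Dg fg] := is_D_measure mg_hob mg0 x0 xy.
have [Dh fh] := is_D_measure mh_hob mh0 x0 xy.
exists (fine (mg (box x y)) - fine (mh (box x y))); last by rewrite EFinB !fineK.
move=> s ps; apply: eq_iter_lim (iter_limB (Dg s ps) (Dh s ps)) => // q q0 /=.
rewrite fgh//; first by apply: orthantP => i; rewrite mxE le_max lexx.
exact: shrunk_vle.
Qed.

End DecompositionMeasure.

(** * The cycle of implications, and uniqueness of the decomposition *)

Theorem propositionA11 (R : realType) (d : nat) (hd : (0 < d)%N)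
    (f : 'rV[R]_d -> R) (hf : component_right_continuous f) :
  [/\ measure_inducing f <-> generates_signed_measure (F_ f),
      measure_inducing f <->
        (exists g h : 'rV[R]_d -> R, jordan_decomposition f g h),
      measure_inducing f <->
        (exists g h : 'rV[R]_d -> R,
           [/\ component_right_continuous g /\ k_increasing d g,
               component_right_continuous h /\ k_increasing d h,
               bounded_on_orthant g \/ bounded_on_orthant h
             & Delta_decomposition f g h])
    & forall g h g' h' : 'rV[R]_d -> R,
        jordan_decomposition f g h -> jordan_decomposition f g' h' ->
        forall x, orthant x -> g x = g' x /\ h x = h' x].
Proof.
have i_ii := measure_inducing_generates hf.
have ii_iii := generates_jordan hd hf.
have iii_iv : (exists g h, jordan_decomposition f g h) ->
    exists g h : 'rV[R]_d -> R,
      [/\ component_right_continuous g /\ k_increasing d g,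
          component_right_continuous h /\ k_increasing d h,
          bounded_on_orthant g \/ bounded_on_orthant h
        & Delta_decomposition f g h].
  move=> [g [h [[_ rg mg] [_ rh mh] bnd _ [_ _ fgh]]]]; exists g, h.
  by split=> //; split=> //; [apply: mg|apply: mh]; rewrite hd leqnn.
have iv_i : (exists g h : 'rV[R]_d -> R,
      [/\ component_right_continuous g /\ k_increasing d g,
          component_right_continuous h /\ k_increasing d h,
          bounded_on_orthant g \/ bounded_on_orthant h
        & Delta_decomposition f g h]) -> measure_inducing f.
  by move=> [g [h [[rg dg] [rh dh] bnd fgh]]]; exact: decomposition_measure_inducing fgh.
split; [split|split|split|].
- exact: i_ii.
- by move=> /ii_iii/iii_iv.
- by move=> /i_ii.
- by move=> /iii_iv.
- by move=> /i_ii/ii_iii.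
- exact: iv_i.
- by move=> g h g' h' J J' x x0; exact: jordan_decomposition_unique J J' x0.
Qed.
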